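(* Assume that $u \in X$, $\operatorname{div} u = 0$, and $\omega = \operatorname{curl} u \in L^\infty(\mathbb{R}^2)$. Then, for every $x\in\mathbb{R}^2$, $$u(x) \,=\, u(0) + \lim_{R \to \infty}\frac{1}{2\pi}\int_{|y|\le R} \biggl\{\frac{(x-y)^\perp}{|x-y|^2} + \frac{y^\perp}{|y|^2}\biggr\}\,\omega(y)\,dy .$$
   Context: $X$ is the space of bounded, uniformly continuous vector fields $u:\mathbb{R}^2\to\mathbb{R}^2$. $\operatorname{div} u=\partial_1u_1+\partial_2u_2$ and $\operatorname{curl} u = \partial_1 u_2-\partial_2 u_1$, in the sense of distributions. For $z=(z_1,z_2)\in\mathbb{R}^2$, $z^\perp=(-z_2,z_1)$. *)

(* Defs.v *)
From HB Require Import structures.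
From mathcomp Require Import all_boot all_order all_algebra.
From mathcomp Require Import all_classical all_reals all_analysis.

Set Implicit Arguments.
Unset Strict Implicit.
Unset Printing Implicit Defensive.

Import Order.TTheory GRing.Theory Num.Theory.
Import numFieldNormedType.Exports.

Local Open Scope classical_set_scope.
Local Open Scope ring_scope.

(* The plane is R * R.  Its library norm is the sup norm, which induces the
   usual topology and uniformity; Euclidean lengths use [enorm] below. *)

Notation leb2 R := (@lebesgue_measure R \x @lebesgue_measure R)%E.

Definition e1 {R : realType} : R * R := (1, 0).
Definition e2 {R : realType} : R * R := (0, 1).

Definition perp {R : realType} (z : R * R) : R * R := (- z.2, z.1).

Definition enorm {R : realType} (z : R * R) : R :=
  Num.sqrt (z.1 ^+ 2 + z.2 ^+ 2).

Definition edisc {R : realType} (r : R) : set (R * R) :=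
  [set y | enorm y <= r].

Definition BUC {R : realType} : set (R * R -> R * R) :=
  [set u | bounded_fun u /\ unif_continuous u].

Fixpoint Cn {R : realType} (n : nat) (f : R * R -> R) : Prop :=
  if n is m.+1 then
    [/\ continuous f,
        (forall x, derivable f x e1) /\ Cn m (fun x => 'D_e1 f x) &
        (forall x, derivable f x e2) /\ Cn m (fun x => 'D_e2 f x)]
  else continuous f.

Definition test_function {R : realType} : set (R * R -> R) :=
  [set phi | (forall n, Cn n phi) /\ compact (closure [set x | phi x != 0])].

(* Distributions are represented by their action on functions; only the values
   on test functions are meaningful, and [distr_eq] compares exactly those. *)
Definition distr (R : realType) := (R * R -> R) -> R.

Definition distr_eq {R : realType} (S T : distr R) : Prop :=
  forall phi, test_function phi -> S phi = T phi.

Definition distr_of {R : realType} (f : R * R -> R) : distr R :=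
  fun phi => \int[leb2 R]_x (f x * phi x).

Definition distr_partial {R : realType} (v : R * R) (T : distr R) : distr R :=
  fun phi => - T (fun x => 'D_v phi x).

Definition div {R : realType} (u : R * R -> R * R) : distr R := fun phi =>
  distr_partial e1 (distr_of (fun x => (u x).1)) phi +
  distr_partial e2 (distr_of (fun x => (u x).2)) phi.

Definition curl {R : realType} (u : R * R -> R * R) : distr R := fun phi =>
  distr_partial e1 (distr_of (fun x => (u x).2)) phi -
  distr_partial e2 (distr_of (fun x => (u x).1)) phi.

Definition vintegral {R : realType} (D : set (R * R)) (F : R * R -> R * R) :
    R * R :=
  (\int[leb2 R]_(y in D) (F y).1, \int[leb2 R]_(y in D) (F y).2).

(* z^perp / |z|^2; the value at z = 0 (a null set) is 0 since 0^-1 = 0. *)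
Definition BS_kernel {R : realType} (z : R * R) : R * R :=
  (enorm z ^+ 2)^-1 *: perp z.

Definition BS_truncated {R : realType} (omega : R * R -> R) (x : R * R) (r : R) :
    R * R :=
  (2 * pi)^-1 *:
    vintegral (edisc r) (fun y => omega y *: (BS_kernel (x - y) + BS_kernel y)).

(* Main.v *)
Require Import Defs.
From HB Require Import structures.
From mathcomp Require Import all_boot all_order all_algebra.
From mathcomp Require Import all_classical all_reals all_analysis.
From mathcomp Require Import measurable_realfun ess_sup_inf.
From mathcomp Require Import ring lra.

(** In complex notation the equations div u = 0 and curl u = omega say that
    f = u.1 - i u.2 satisfies a d-bar equation whose right-hand side is a multiple of
    omega. The Cauchy-Pompeiu formula on a disc of radius r then writes f(x) - f(0) as the
    truncated Biot-Savart integral plus a contour integral of f against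
    1 / (y - x) - 1 / y. This difference of kernels (called the dipole below) is
    O(|x| / r ^ 2) on the circle, so for bounded f the contour integral is O(1 / r).

    Since u is merely continuous and omega merely bounded, the formula is derived by
    testing the weak equations ([weak_div_curl]) against a cutoff times a regularized
    dipole, in which |y - a| ^ 2 is replaced by e ^ 2 + |y - a| ^ 2. The divergence of the
    regularized kernel is an approximate identity of mass 2 pi ([integral_mollifier],
    [approximate_identity]) and its curl vanishes, so testing against this field and
    against its rotation isolates u.1 and u.2 ([field_identity1], [field_identity2]).
    With the radius fixed, e tends to 0: one side converges by the approximate identity, the
    other one by dominated convergence, because the singular kernel is locally integrable
    ([integral_mul_kernel_cvg]).

    The cutoff depends smoothly on |y| ^ 2 and drops from 1 to 0 on the annulus
    r ^ 2 <= |y| ^ 2 <= r ^ 2 + r, where its gradient is O(1). Both the boundary terms and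
    the replacement of the cutoff by the indicator of the disc are integrals over this
    annulus of quantities of size O(r ^ -2) ([dipole_le]). The area of the annulus is
    O(r ^ (3/2)) by an elementary count of its sections ([annulus_area]), so the total
    error is O(r ^ (-1/2)) ([dipole_estimate], [inv_sqrt_rate_cvg]).

    Test functions come from an inductive class of smooth functions containing the
    coordinates, closed under the ring operations, inversion and composition with
    P(1/t) exp(-1/t); smoothness of every order follows from its stability under
    differentiation ([smooth_Cn]). *)

Set Implicit Arguments.
Unset Strict Implicit.
Unset Printing Implicit Defensive.

Import Order.TTheory GRing.Theory Num.Theory.
Import numFieldNormedType.Exports.

Local Open Scope classical_set_scope.
Local Open Scope ring_scope.

(** * Functions flat at the origin *)

Section FlatFunctions.
Context {R : realType}.
Implicit Types (P : {poly R}) (t : R).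

(** The functions P(1/t) exp(-1/t), extended by 0 to t <= 0, form a family closed under
    differentiation, so the smoothness of exp(-1/t) needs no iterated estimates. *)
Definition flat P t : R := if 0 < t then P.[t^-1] * expR (- t^-1) else 0.

Lemma horner_power_bound P :
  exists2 C : R, 0 <= C & exists n, forall s, 0 <= s -> `|P.[s]| <= C * (1 + s) ^+ n.
Proof.
elim/poly_ind: P => [|P c [C C0 [n HC]]].
  by exists 0 => //; exists 0%N => s _; rewrite horner0 normr0 mul0r.
exists (C + `|c|); first by rewrite addr_ge0.
exists n.+1 => s s0; rewrite hornerMXaddC.
rewrite (le_trans (ler_normD _ _))// mulrDl lerD//.
  rewrite normrM exprSr mulrA ler_pM// ?HC// ger0_norm//; lra.
rewrite ler_peMr// exprn_ege1//; lra.
Qed.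

Lemma expR_power_bound (n : nat) (s : R) : 0 <= s ->
  (1 + s) ^+ n.+1 <= n.+1%:R ^+ n.+1 * expR s.
Proof.
move=> s0.
have n0 : n.+1%:R != 0 :> R by rewrite pnatr_eq0.
(* Raise the inequality 1 + s / n.+1 <= exp (s / n.+1) to the power n.+1. *)
have -> : expR s = expR (s / n.+1%:R) ^+ n.+1.
  by rewrite -expRM_natr divfK.
rewrite -exprMn lerXn2r// ?nnegrE; [lra| |].
  by rewrite mulr_ge0// expR_ge0.
have h := expR_ge1Dx (s / n.+1%:R).
have n1 : 1 <= n.+1%:R :> R by rewrite ler1n.
apply: (@le_trans _ _ (n.+1%:R * (1 + s / n.+1%:R))); last by rewrite ler_pM2l// ltr0n.
by rewrite mulrDr mulr1 mulrCA divff// mulr1 lerD2r.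
Qed.

(** Exponential decay beats the polynomial growth of P(1/t); the exponent 2 makes
    the difference quotient at the origin tend to 0. *)
Lemma flat_quadratic P : exists2 C : R, 0 <= C & forall t, `|flat P t| <= C * t ^+ 2.
Proof.
have [C C0 [n HC]] := horner_power_bound P.
exists (C * n.+2%:R ^+ n.+2); first by rewrite mulr_ge0// exprn_ge0.
move=> t; rewrite /flat; case: ifPn => t0; last first.
  by rewrite normr0 mulr_ge0// ?sqr_ge0// mulr_ge0// exprn_ge0.
have s0 : 0 <= t^-1 by rewrite invr_ge0 ltW.
rewrite normrM (ger0_norm (expR_ge0 _)) expRN ler_pdivrMr ?expR_gt0//.
have := expR_power_bound n.+1 s0.
set N := n.+2%:R ^+ n.+2; set e := expR _ => hN.
apply: (le_trans (HC _ s0)); rewrite -(mulrA C) -(mulrA C) ler_wpM2l//.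
rewrite mulrAC -[t in t ^+ 2]invrK exprVn ler_pdivlMr ?exprn_gt0 ?invr_gt0//.
apply: le_trans hN; rewrite -(addn2 n) exprD ler_wpM2l//.
  by rewrite exprn_ge0// addr_ge0.
by rewrite lerXn2r// ?nnegrE ?addr_ge0// lerDr.
Qed.

Lemma flat0 P : flat P 0 = 0.
Proof. by rewrite /flat ltxx. Qed.

(** By the chain rule, d/dt P(1/t) exp(-1/t) = (P - P')(1/t) / t ^ 2 * exp(-1/t). *)
Definition flat_deriv P : {poly R} := 'X^2 * (P - P^`()).

Lemma is_derive_flat P t : is_derive t 1 (flat P) (flat (flat_deriv P) t).
Proof.
have [t0|t0|->] := ltgtP t 0.
- apply: (@near_eq_is_derive _ _ _ (cst 0)).
    near=> s; rewrite /flat ifN// -leNgt ltW//.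
    by near: s; exact: lt_nbhsl.
  rewrite /flat ifN; first exact: is_derive_cst.
  by rewrite -leNgt ltW.
- have tn0 : t != 0 by rewrite gt_eqF.
  apply: (@near_eq_is_derive _ _ _ (fun t => P.[t^-1] * expR (- t^-1))).
    near=> s; rewrite /flat ifT//.
    by near: s; exact: lt_nbhsr.
  have dV : is_derive t 1 (fun y : R => y^-1) (- t ^- 2 *: 1).
    exact: (@is_deriveV _ id).
  have dP := @is_derive1_comp _ (horner P) (fun y => y^-1) t _ _ (is_derive_poly _ _) dV.
  have dE := @is_derive1_comp _ expR (fun y => - y^-1) t _ _ (is_derive_expR _) (is_deriveN dV).
  have := is_deriveM dP dE.
  move/is_derive_eq; apply.
  rewrite /flat t0 /flat_deriv !hornerE /= /GRing.scale /=.
  set e := expR _; set p := P.[_]; set q := (P^`()).[_].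
  by rewrite exprVn; ring.
- rewrite flat0.
  apply/is_derive1_caratheodory; exists (fun z => z^-1 * flat P z); split.
  + move=> z; rewrite flat0 !subr0.
    have [->|z0] := eqVneq z 0; first by rewrite flat0 !mulr0.
    by rewrite mulrC mulrA divff// mul1r.
  + have [C C0 HC] := flat_quadratic P.
    rewrite /prop_for /continuous_at /= flat0 mulr0.
    apply/cvgr0Pnorm_lt => e e0.
    near=> z.
    have [->|z0] := eqVneq z 0; first by rewrite flat0 mulr0 normr0.
    rewrite normrM normfV ltr_pdivrMl ?normr_gt0//.
    rewrite (le_lt_trans (HC z))// -real_normK ?num_real// expr2 mulrA.
    rewrite mulrC ltr_pM2l ?normr_gt0//.
    have h : `|z| < e / (C + 1).
      near: z; apply: (@nbhs0_lt R R).
      by rewrite divr_gt0//; lra.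
    move: h; rewrite ltr_pdivlMr; last lra.
    by apply: le_lt_trans; rewrite mulrC ler_wpM2l// lerDl.
  + by rewrite flat0 mulr0.
Unshelve. all: by end_near. Qed.
End FlatFunctions.

(** * A derivative-stable class of smooth functions on the plane *)

Section SmoothClass.
Context {R : realType}.
Implicit Types (f g : R * R -> R) (v x : R * R).

(** Reduces a directional derivative to a derivative on the line, where the chain rule
    for one real variable applies. *)
Lemma is_derive_lineP f x v (d : R) :
  is_derive x v f d <-> is_derive (0 : R) 1 (fun h : R => f (h *: v + x)) d.
Proof.
have E : (fun h : R => h^-1 *: ((f \o shift x) (h *: v) - f x)) =
    (fun h : R => h^-1 *: (((fun h : R => f (h *: v + x)) \o shift 0) h%:A -
       (fun h : R => f (h *: v + x)) 0)).
  by rewrite funeqE => h /=; rewrite addr0 scale0r add0r [_%:A]mulr1.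
by split=> -[D V]; split; [rewrite /derivable -E|rewrite /derive -E|
  rewrite /derivable E|rewrite /derive E].
Qed.

Lemma is_derive_comp_line (h : R -> R) f x v (a b : R) :
  is_derive (f x) 1 h a -> is_derive x v f b -> is_derive x v (h \o f) (a * b).
Proof.
move=> Dh /is_derive_lineP Df; apply/is_derive_lineP.
apply: (@is_derive1_comp _ h (fun t : R => f (t *: v + x))) => //.
by rewrite scale0r add0r.
Qed.

Lemma is_derive_fst x v : is_derive x v fst v.1.
Proof.
have h : \forall h \near 0^', h^-1 *: ((fst \o shift x) (h *: v) - x.1) = v.1.
  near=> h; rewrite /= addrK scalerA mulVf ?scale1r//.
  by near: h; exact: nbhs_dnbhs_neq.
split; first exact: (is_cvg_near_cst v.1).
exact: lim_near_cst.
Unshelve. all: by end_near. Qed.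

Lemma is_derive_snd x v : is_derive x v snd v.2.
Proof.
have h : \forall h \near 0^', h^-1 *: ((snd \o shift x) (h *: v) - x.2) = v.2.
  near=> h; rewrite /= addrK scalerA mulVf ?scale1r//.
  by near: h; exact: nbhs_dnbhs_neq.
split; first exact: (is_cvg_near_cst v.2).
exact: lim_near_cst.
Unshelve. all: by end_near. Qed.

(** An inductively generated class: one induction shows that it is stable under
    differentiation, and stability gives all orders of differentiability at once,
    instead of a Leibniz or chain rule of order n for each operation. *)
Inductive smooth : (R * R -> R) -> Prop :=
| smooth_cst c : smooth (fun=> c)
| smooth_fst : smooth fst
| smooth_snd : smooth snd
| smoothD f g : smooth f -> smooth g -> smooth (fun y => f y + g y)
| smoothM f g : smooth f -> smooth g -> smooth (fun y => f y * g y)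
| smoothV f : (forall y, f y != 0) -> smooth f -> smooth (fun y => (f y)^-1)
| smooth_flat P f : smooth f -> smooth (fun y => flat P (f y)).

Lemma smoothN f : smooth f -> smooth (fun y => - f y).
Proof.
move=> sf; rewrite (_ : (fun=> _) = (fun y => -1 * f y)).
  exact/smoothM/sf/smooth_cst.
by apply/funext => y; rewrite mulN1r.
Qed.

Lemma smoothB f g : smooth f -> smooth g -> smooth (fun y => f y - g y).
Proof. by move=> sf sg; apply: smoothD => //; exact: smoothN. Qed.

Lemma smooth_continuous f : smooth f -> continuous f.
Proof.
elim=> {f} [c|||f g _ cf _ cg|f g _ cf _ cg|f f0 _ cf|P f _ cf] x.
- exact: cvg_cst.
- exact: cvg_fst.
- exact: cvg_snd.
- exact: (cvgD (cf x) (cg x)).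
- exact: (cvgM (cf x) (cg x)).
- exact: (cvgV (f0 x) (cf x)).
- apply: (@continuous_comp _ _ _ f (flat P)); first exact: cf.
  apply/differentiable_continuous/derivable1_diffP.
  by have [] := is_derive_flat P (f x).
Qed.

Lemma smooth_derive v f : smooth f ->
  exists2 f', smooth f' & forall x, is_derive x v f (f' x).
Proof.
elim=> {f} [c|||f g sf [f' sf' Df] sg [g' sg' Dg]|f g sf [f' sf' Df] sg [g' sg' Dg]
   |f f0 sf [f' sf' Df]|P f sf [f' sf' Df]].
- by exists (fun=> 0); [exact: smooth_cst|move=> x; exact: is_derive_cst].
- by exists (fun=> v.1); [exact: smooth_cst|move=> x; exact: is_derive_fst].
- by exists (fun=> v.2); [exact: smooth_cst|move=> x; exact: is_derive_snd].
- exists (fun y => f' y + g' y); first exact: smoothD.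
  by move=> x; exact: is_deriveD.
- exists (fun y => f y * g' y + g y * f' y).
    by apply: smoothD; exact: smoothM.
  by move=> x; exact: is_deriveM.
- exists (fun y => - ((f y)^-1 * (f y)^-1) * f' y).
    by apply: smoothM => //; apply/smoothN/smoothM; exact: smoothV.
  move=> x; have := Df x => Dfx.
  have := is_derive_lineP (fun y => (f y)^-1) x v (- ((f x)^-1 * (f x)^-1) * f' x).
  case=> _; apply.
  move/is_derive_lineP in Dfx.
  have n0 : f (0 *: v + x) != 0 by [].
  have := @is_deriveV _ (fun h : R => f (h *: v + x)) 0 _ 1 n0 Dfx.
  move/is_derive_eq; apply.
  by rewrite scale0r add0r -exprVn expr2 /GRing.scale /= mulNr.
- exists (fun y => flat (flat_deriv P) (f y) * f' y).
    by apply: smoothM => //; exact: smooth_flat.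
  by move=> x; apply: is_derive_comp_line => //; exact: is_derive_flat.
Qed.

Lemma smooth_Cn n f : smooth f -> Cn n f.
Proof.
elim: n f => [|n IH] f sf; first exact: smooth_continuous.
have D v : (forall x, derivable f x v) /\ Cn n (fun x => 'D_v f x).
  have [f' sf' Df] := smooth_derive v sf; split.
    by move=> x; have [] := Df x.
  have -> : (fun x => 'D_v f x) = f'; last exact: IH.
  by apply/funext => x; have [] := Df x.
by split; [exact: smooth_continuous|exact: D|exact: D].
Qed.

End SmoothClass.

(** * Measurability and test functions on the plane *)

Section PlaneMeasurability.
Context {R : realType}.
Implicit Types (f g : R * R -> R).

(** An open set is a countable union of rectangles with rational corners, and
    rectangles generate the product sigma-algebra. *)
Lemma open_measurable_plane (A : set (R * R)) : open A -> measurable A.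
Proof.
move=> oA.
pose box (q : (rat * rat) * (rat * rat)) : set (R * R) :=
  `]ratr q.1.1, ratr q.1.2[ `*` `]ratr q.2.1, ratr q.2.2[.
have -> : A = \bigcup_q (if `[< box q `<=` A >] then box q else set0).
  apply/seteqP; split => [y Ay|y [q _]]; last first.
    by case: asboolP => // h; exact: h.
  have /nbhs_ballP[e /= e0 eA] : nbhs y A by exact: open_nbhs_nbhs.
  have [a] : exists a, ratr a \in `]y.1 - e, y.1[ by apply: rat_in_itvoo; lra.
  have [b] : exists a, ratr a \in `]y.1, y.1 + e[ by apply: rat_in_itvoo; lra.
  have [c] : exists a, ratr a \in `]y.2 - e, y.2[ by apply: rat_in_itvoo; lra.
  have [d] : exists a, ratr a \in `]y.2, y.2 + e[ by apply: rat_in_itvoo; lra.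
  rewrite !in_itv /= => /andP[d1 d2] /andP[c1 c2] /andP[b1 b2] /andP[a1 a2].
  exists ((a, b), (c, d)) => //; case: asboolP => [_|]; last first.
    case=> z [] /=; rewrite !in_itv /= => /andP[z1 z2] /andP[z3 z4].
    by apply: eA; split; rewrite /ball /= ltr_distlC; apply/andP; split; lra.
  by split; rewrite /= in_itv /=; apply/andP.
apply: countable_bigcupT_measurable => [|q]; first exact: countableP.
by case: ifP => // _; apply: measurableX; exact: measurable_itv.
Qed.

Lemma continuous_measurable_plane f : continuous f -> measurable_fun setT f.
Proof.
move=> /continuousP cf; apply: (measurability _ (measurable_realfun.RGenOInfty.measurableE R)).
move=> _ [_ [a ->] <-]; rewrite setTI; apply: open_measurable_plane.
exact/cf/interval_open.
Qed.

(** Inversion is continuous on the complement of 0, and the singleton of 0 is measurable. *)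
Lemma measurable_fun_inv d (T : measurableType d) (D : set T) (h : T -> R) :
  measurable_fun D h -> measurable_fun D (fun y => (h y)^-1).
Proof.
move=> mh; apply: (@measurableT_comp _ _ _ _ _ _ (fun t : R => t^-1)) => //.
rewrite (_ : setT = [set 0] `|` ~` [set (0 : R)]); last by rewrite setUv.
have mN : measurable (~` [set (0 : R)]) by apply: measurableC.
apply/measurable_funU => //; split; first exact: measurable_fun_set1.
apply: open_continuous_measurable_fun.
  by apply: closed_openC; exact: closed_eq.
by move=> x; rewrite inE => /eqP x0; exact: inv_continuous.
Qed.

Lemma compact_box (L : R) : compact (`[- L, L] `*` `[- L, L]).
Proof. by apply: compact_setX; exact: segment_compact. Qed.

Arguments compact_box : clear implicits.
Lemma smooth_test_function f (L : R) : smooth f ->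
  (forall y, f y != 0 -> `|y.1| <= L /\ `|y.2| <= L) -> test_function f.
Proof.
move=> sf fL; split; first by move=> n; exact: smooth_Cn.
refine (subclosed_compact _ (compact_box L) _); first exact: closed_closure.
have cB : closed (`[- L, L] `*` `[- L, L] : set (R * R)).
  by apply: (compact_closed _ (compact_box L)); exact: norm_hausdorff.
rewrite [X in _ `<=` X]((closure_id _).1 cB); apply: closureS => y /= /fL[h1 h2].
by split; rewrite /= in_itv /= -ler_norml.
Qed.

End PlaneMeasurability.

(** * Integrals over the line *)

Section LineIntegrals.
Context {R : realType}.
Notation mu := (@lebesgue_measure R).
Implicit Types (f F : R -> R).

Lemma cvg_pinfty_inv_bound F (C l : R) :
  (forall t, 1 <= t -> `|l - F t| <= C / t) -> F t @[t --> +oo] --> l.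
Proof.
move=> FC; apply/cvgrPdist_le => e e0; near=> t.
have t1 : 1 <= t by near: t; apply: nbhs_pinfty_ge => //; exact: num_real.
rewrite (le_trans (FC _ t1))// ler_pdivrMr; last lra.
rewrite -ler_pdivrMl//; near: t; apply: nbhs_pinfty_ge => //; exact: num_real.
Unshelve. all: by end_near. Qed.

(** The fundamental theorem of calculus on each half line; nonnegativity of the
    integrand makes the improper integral a Lebesgue integral. *)
Lemma integral_line_FTC f F (l L : R) :
  (forall t, 0 <= f t) -> continuous f -> (forall t : R, is_derive t 1 F (f t)) ->
  F t @[t --> -oo] --> l -> F t @[t --> +oo] --> L ->
  (\int[mu]_t (f t)%:E = (L - l)%:E)%E.
Proof.
move=> f0 cf DF Fl FL.
have mf : measurable_fun [set: R] f by exact: continuous_measurable_fun.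
have cF : continuous F.
  move=> t; apply/differentiable_continuous/derivable1_diffP.
  by have [] := DF t.
rewrite -(setUv [set` `[(0 : R), +oo[]) ge0_integral_setU//= ; last 4 first.
  exact: measurableC.
  by apply/measurable_EFinP; rewrite setUv.
  by move=> x _; rewrite lee_fin.
  exact/disj_setPCl.
rewrite setCitvr (@ge0_continuous_FTC2y _ f F 0 L)//; last 3 first.
- exact: continuous_subspaceT.
- by apply: cvg_at_right_filter; exact: cF.
- by move=> t _; rewrite derive1E; have [] := DF t.
rewrite integral_itv_bndo_bndc; last exact/measurable_EFinP/measurable_funTS.
rewrite -{2}oppr0 ge0_integration_by_substitutionNy//; last exact: continuous_subspaceT.
have DG (t : R) : is_derive t 1 (fun s => - F (- s)) (f (- t)).
  have DN : is_derive t (1:R) (@GRing.opp R) (- 1) by exact: is_deriveNid.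
  have := is_deriveN (@is_derive1_comp _ F -%R t _ _ (DF (- t)) DN).
  by move/is_derive_eq; apply; rewrite mulrN1 opprK.
rewrite (@ge0_continuous_FTC2y _ (f \o -%R) (fun s => - F (- s)) 0 (- l))//.
- by rewrite -!EFinB -EFinD oppr0 opprK; congr (_%:E); ring.
- by move=> t _; exact: f0.
- apply: continuous_subspaceT => t.
  by apply: continuous_comp; [exact: oppr_continuous|exact: cf].
- by apply: cvgN; move/cvgNy_compNP : Fl.
- apply: cvg_at_right_filter; apply: cvgN.
  by apply: continuous_comp; [exact: oppr_continuous|exact: cF].
- by move=> t _; rewrite derive1E; have [] := DG t.
Qed.

(** The line integrals needed for the kernels have an odd primitive up to a shift, so a single
    limit at +oo computes them. *)
Lemma integral_line_odd_primitive f F (a L : R) :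
  (forall t, 0 <= f t) -> continuous f -> (forall t : R, is_derive t 1 F (f t)) ->
  (forall t, F (- t) = - F t) -> F t @[t --> +oo] --> L ->
  (\int[mu]_t (f (t - a))%:E = (2 * L)%:E)%E.
Proof.
move=> f0 cf DF Fodd FL.
have FNL : F t @[t --> -oo] --> - L.
  apply/cvgNy_compNP; apply: cvg_trans (cvgN FL).
  by apply: near_eq_cvg; near=> t; rewrite /= Fodd.
have DG (t : R) : is_derive t 1 (fun t => F (t - a)) (f (t - a)).
  have D := is_deriveB (@is_derive_id _ _ t 1) (@is_derive_cst _ _ _ a t 1).
  have := @is_derive1_comp _ F (fun t => t - a) t _ _ (DF _) D.
  by move/is_derive_eq; apply; rewrite subr0 mulr1.
rewrite (@integral_line_FTC (fun t => f (t - a)) (fun t => F (t - a)) (- L) L _ _ DG)//.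
- by congr (_%:E); ring.
- by move=> t; apply: continuous_comp; [by apply: cvgB; [exact: cvg_id|exact: cvg_cst]|exact: cf].
- apply: (cvg_comp _ _ _ FNL); apply/cvgrNyPle => A; near=> t.
  rewrite lerBlDr; near: t; apply: nbhs_ninfty_le; exact: num_real.
- apply: (cvg_comp _ _ _ FL); apply/cvgryPge => A; near=> t.
  rewrite lerBrDr; near: t; apply: nbhs_pinfty_ge => //; exact: num_real.
Unshelve. all: by end_near. Qed.

Lemma atan_div_cvg (c : R) : 0 < c -> atan (t / c) @[t --> +oo] --> pi / 2.
Proof.
move=> c0; apply: (@cvg_comp _ _ _ (fun t : R => t / c) (@atan R)) (@cvgy_atan R).
apply/cvgryPge => A; near=> t.
by rewrite ler_pdivlMr//; near: t; apply: nbhs_pinfty_ge => //; exact: num_real.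
Unshelve. all: by end_near. Qed.

Lemma is_derive_atan_div (c t : R) : 0 < c ->
  is_derive t 1 (fun t => atan (t / c)) (c / (c ^+ 2 + t ^+ 2)).
Proof.
move=> c0.
have D := is_deriveM (@is_derive_id _ _ t 1) (@is_derive_cst _ _ _ c^-1 t 1).
have := @is_derive1_comp _ atan (fun t => t / c) t _ _ (is_derive1_atan _) D.
move/is_derive_eq; apply.
rewrite /GRing.scale /=.
have c2 : c ^+ 2 + t ^+ 2 != 0 by rewrite gt_eqF// ltr_pwDl ?exprn_gt0// sqr_ge0.
have c3 : 1 + (t / c) ^+ 2 != 0 by rewrite gt_eqF// ltr_pwDl ?sqr_ge0.
by field; rewrite c2 gt_eqF.
Qed.

Lemma sum_sqr_gt0 (c t : R) : 0 < c -> 0 < c ^+ 2 + t ^+ 2.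
Proof. by move=> c0; rewrite ltr_pwDl ?exprn_gt0// sqr_ge0. Qed.

Lemma is_derive_sum_sqr (c t : R) :
  is_derive t 1 (fun t => c ^+ 2 + t ^+ 2) (2 * t).
Proof.
have := is_deriveD (@is_derive_cst _ _ _ (c ^+ 2) t 1) (is_deriveX 2 (@is_derive_id _ _ t 1)).
by move/is_derive_eq; apply; rewrite /GRing.scale /= add0r mulr1 expr1.
Qed.

Lemma continuous_inv_sum_sqr (c : R) : 0 < c ->
  continuous (fun t : R => (c ^+ 2 + t ^+ 2)^-1).
Proof.
move=> c0 t; apply: cvgV; first by rewrite gt_eqF// sum_sqr_gt0.
by apply: cvgD; [exact: cvg_cst|exact: exprn_continuous].
Qed.

Lemma integral_cauchy (c a : R) : 0 < c ->
  (\int[mu]_t (c / (c ^+ 2 + (t - a) ^+ 2))%:E = pi%:E)%E.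
Proof.
move=> c0.
rewrite (@integral_line_odd_primitive (fun t => c / (c ^+ 2 + t ^+ 2))
  (fun t => atan (t / c)) a (pi / 2) _ _ (fun t => is_derive_atan_div t c0)).
- by congr (_%:E); field.
- by move=> t; rewrite divr_ge0// ltW// sum_sqr_gt0.
- by move=> t; apply: cvgM; [exact: cvg_cst|exact: continuous_inv_sum_sqr].
- by move=> t; rewrite mulNr atanN.
- exact: (atan_div_cvg c0).
Qed.

Lemma integral_inv_sum_sqr2 (c a : R) : 0 < c ->
  (\int[mu]_t ((c ^+ 2 + (t - a) ^+ 2) ^- 2)%:E = (pi / (2 * c ^+ 3))%:E)%E.
Proof.
move=> c0; have cn0 : c != 0 by rewrite gt_eqF.
(* The classical primitive of the squared Cauchy density. *)
pose F t : R := t / (2 * c ^+ 2) * (c ^+ 2 + t ^+ 2)^-1 + atan (t / c) / (2 * c ^+ 3).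
have DF (t : R) : is_derive t 1 F ((c ^+ 2 + t ^+ 2) ^- 2).
  have s0 := sum_sqr_gt0 t c0.
  have D1 := is_deriveM (@is_derive_id _ _ t 1) (@is_derive_cst _ _ _ (2 * c ^+ 2)^-1 t 1).
  have D2 := is_derive_sum_sqr c t.
  have D3 := @is_deriveV _ _ t _ 1 (lt0r_neq0 s0) D2.
  have D4 := is_deriveM (is_derive_atan_div t c0) (@is_derive_cst _ _ _ (2 * c ^+ 3)^-1 t 1).
  have := is_deriveD (is_deriveM D1 D3) D4.
  move/is_derive_eq; apply.
  rewrite /GRing.scale /= !fctE /=.
  by field; rewrite cn0 gt_eqF.
rewrite (@integral_line_odd_primitive (fun t => (c ^+ 2 + t ^+ 2) ^- 2) F a (pi / (4 * c ^+ 3)) _ _ DF).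
- by congr (_%:E); field.
- by move=> t; rewrite invr_ge0 sqr_ge0.
- move=> t; have := continuous_inv_sum_sqr c0 => /(_ t) h.
  rewrite (_ : (fun t : R => _) = (fun t : R => (c ^+ 2 + t ^+ 2)^-1 * (c ^+ 2 + t ^+ 2)^-1)).
    exact: (cvgM h h).
  by apply/funext => s; rewrite -expr2 exprVn.
- by move=> t; rewrite /F sqrrN !mulNr atanN; ring.
- have -> : pi / (4 * c ^+ 3) = 0 + pi / 2 / (2 * c ^+ 3) by field.
  have h2 : atan (t / c) * (2 * c ^+ 3)^-1 @[t --> +oo] --> pi / 2 / (2 * c ^+ 3).
    by apply: cvgM; [exact: (atan_div_cvg c0)|exact: cvg_cst].
  apply: cvgD h2.
  apply: (@cvg_pinfty_inv_bound _ ((2 * c ^+ 2)^-1)) => t t1.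
  have t0 : 0 < t by lra.
  rewrite sub0r normrN ger0_norm; last first.
    by rewrite mulr_ge0 ?invr_ge0 ?divr_ge0 ?mulr_ge0 ?sqr_ge0 ?(ltW t0)// ltW// sum_sqr_gt0.
  rewrite mulrAC mulrC; apply: ler_wpM2l; first by rewrite invr_ge0 mulr_ge0// sqr_ge0.
  rewrite ler_pdivrMr ?sum_sqr_gt0// mulrC ler_pdivlMr// -expr2.
  by rewrite lerDr sqr_ge0.
Unshelve. all: by end_near. Qed.

Lemma integral_inv_sqrt_sum_sqr3 (c a : R) : 0 < c ->
  (\int[mu]_t (c ^+ 2 / Num.sqrt (c ^+ 2 + (t - a) ^+ 2) ^+ 3)%:E = 2%:E)%E.
Proof.
move=> c0; have cn0 : c != 0 by rewrite gt_eqF.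
pose r t : R := Num.sqrt (c ^+ 2 + t ^+ 2).
have r0 t : 0 < r t by rewrite sqrtr_gt0 sum_sqr_gt0.
have rE t : r t ^+ 2 = c ^+ 2 + t ^+ 2 by rewrite sqr_sqrtr// ltW// sum_sqr_gt0.
have cr : continuous r.
  move=> t; apply: (@continuous_comp _ _ _ (fun t : R => c ^+ 2 + t ^+ 2) (@Num.sqrt R)).
    by apply: cvgD; [exact: cvg_cst|exact: exprn_continuous].
  exact: sqrt_continuous.
have DF (t : R) : is_derive t 1 (fun t => t / r t) (c ^+ 2 / r t ^+ 3).
  have D2 := is_derive_sum_sqr c t.
  have D3 := @is_derive1_comp _ Num.sqrt (fun t => c ^+ 2 + t ^+ 2) t _ _
    (is_derive1_sqrt (sum_sqr_gt0 t c0)) D2.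
  have D4 := @is_deriveV _ r t _ 1 (lt0r_neq0 (r0 t)) D3.
  have := is_deriveM (@is_derive_id _ _ t 1) D4.
  move/is_derive_eq; apply.
  rewrite /GRing.scale /= -/(r t).
  have -> : c ^+ 2 = r t ^+ 2 - t ^+ 2 by rewrite rE addrK.
  by field; rewrite gt_eqF.
rewrite (@integral_line_odd_primitive (fun t => c ^+ 2 / r t ^+ 3) (fun t => t / r t) a 1 _ _ DF).
- by rewrite mulr1.
- by move=> t; rewrite divr_ge0 ?sqr_ge0// exprn_ge0// ltW.
- move=> t; apply: cvgM; first exact: cvg_cst.
  apply: cvgV; first by rewrite expf_neq0// gt_eqF.
  by apply: (@continuous_comp _ _ _ r (fun z => z ^+ 3)); [exact: cr|exact: exprn_continuous].
- by move=> t; rewrite mulNr /r sqrrN.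
- apply: (@cvg_pinfty_inv_bound _ c) => t t1.
  have t0 : 0 < t by lra.
  have rt : t <= r t by rewrite -(@ler_pXn2r _ 2)// ?nnegrE ?(ltW t0) ?(ltW (r0 t))// rE lerDr sqr_ge0.
  have rc : r t <= t + c.
    rewrite -(@ler_pXn2r _ 2)// ?nnegrE ?(ltW (r0 t))//; last lra.
    by rewrite rE sqrrD; nra.
  rewrite ger0_norm; last by rewrite subr_ge0 ler_pdivrMr// mul1r.
  rewrite lerBlDr -(mulfV (lt0r_neq0 t0)) -subr_ge0.
  have -> : c / t + t / r t - t / t = (c * r t + t ^+ 2 - t * r t) / (t * r t).
    by field; rewrite !gt_eqF.
  have rt0 : 0 < r t := r0 t.
  by apply: divr_ge0; [nra|rewrite mulr_ge0// ltW].
Qed.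
End LineIntegrals.

(** * Integrals over the plane *)

Section PlaneIntegrals.
Context {R : realType}.
Notation mu := (@lebesgue_measure R).
Implicit Types (f g : R * R -> R) (a y : R * R) (e L : R).

Definition plane_integrable f := (leb2 R).-integrable setT (EFin \o f).

Lemma plane_integrable_le f g : measurable_fun setT f ->
  (forall y, `|f y| <= g y) -> plane_integrable g -> plane_integrable f.
Proof.
move=> mf fg Ig; apply: (le_integrable measurableT _ _ Ig).
  exact/measurable_EFinP.
by move=> y _ /=; rewrite lee_fin (le_trans (fg y))// ler_norm.
Qed.

Lemma plane_integrableD f g : plane_integrable f -> plane_integrable g ->
  plane_integrable (fun y => f y + g y).
Proof. by move=> If Ig; have := integrableD measurableT If Ig. Qed.

Lemma plane_integrableZ (k : R) f : plane_integrable f ->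
  plane_integrable (fun y => k * f y).
Proof. by move=> If; have := integrableZl measurableT k If. Qed.

Lemma plane_integrable_measurable f : plane_integrable f -> measurable_fun setT f.
Proof. by move/integrableP => [/measurable_EFinP]. Qed.

Lemma norm_integral_le f g : measurable_fun setT f ->
  (forall y, `|f y| <= g y) -> plane_integrable g ->
  `|\int[leb2 R]_y f y| <= \int[leb2 R]_y g y.
Proof.
move=> mf fg Ig; have If := plane_integrable_le mf fg Ig.
apply: le_trans (le_normr_Rintegral measurableT If) _.
apply: le_Rintegral => //.
apply: plane_integrable_le Ig; first exact: measurableT_comp.
by move=> y; rewrite normr_id.
Qed.

Lemma plane_tonelli f : measurable_fun setT f -> (forall y, 0 <= f y) ->
  (\int[leb2 R]_y (f y)%:E = \int[mu]_t \int[mu]_s (f (t, s))%:E)%E.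
Proof.
move=> mf f0; apply: (@fubini_tonelli1 _ _ _ _ _ mu mu (EFin \o f)).
  exact/measurable_EFinP.
by move=> y; rewrite lee_fin.
Qed.

(** The regularized squared distance e ^ 2 + |y - a| ^ 2; the value e = 0 gives the
    singular denominator of the Biot-Savart kernel. *)
Definition shifted_sqr e a y : R := e ^+ 2 + (y.1 - a.1) ^+ 2 + (y.2 - a.2) ^+ 2.

Lemma shifted_sqr_ge0 e a y : 0 <= shifted_sqr e a y.
Proof. by rewrite !addr_ge0// sqr_ge0. Qed.

Lemma shifted_sqr_gt0 e a y : 0 < e -> 0 < shifted_sqr e a y.
Proof. by move=> e0; rewrite /shifted_sqr -addrA ltr_pwDl ?exprn_gt0// addr_ge0// sqr_ge0. Qed.

Lemma smooth_shift1 a : smooth (fun y => y.1 - a.1).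
Proof. by apply: smoothB; [exact: smooth_fst|exact: smooth_cst]. Qed.

Lemma smooth_shift2 a : smooth (fun y => y.2 - a.2).
Proof. by apply: smoothB; [exact: smooth_snd|exact: smooth_cst]. Qed.

Lemma smooth_shifted_sqr e a : smooth (shifted_sqr e a).
Proof.
apply: smoothD; first apply: smoothD; first exact: smooth_cst.
  by apply: smoothM; exact: smooth_shift1.
by apply: smoothM; exact: smooth_shift2.
Qed.

Lemma smooth_measurable f : smooth f -> measurable_fun setT f.
Proof. by move=> sf; apply: continuous_measurable_plane; exact: smooth_continuous. Qed.

Lemma measurable_shifted_sqr e a : measurable_fun setT (shifted_sqr e a).
Proof. by apply: smooth_measurable; exact: smooth_shifted_sqr. Qed.

(** The divergence of the regularized field (y - a) / (e ^ 2 + |y - a| ^ 2), hence the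
    approximate identity produced by testing the equations against that field. *)
Definition mollifier e a y : R := 2 * e ^+ 2 / shifted_sqr e a y ^+ 2.

Lemma mollifier_ge0 e a y : 0 <= mollifier e a y.
Proof. by rewrite divr_ge0 ?sqr_ge0// mulr_ge0// sqr_ge0. Qed.

Lemma measurable_mollifier e a : measurable_fun setT (mollifier e a).
Proof.
apply: measurable_funM; first exact: measurable_cst.
apply/measurable_fun_inv/measurable_funX. exact: measurable_shifted_sqr.
Qed.

(** Tonelli: the inner integral of 2 e ^ 2 / (c ^ 2 + s ^ 2) ^ 2, with
    c ^ 2 = e ^ 2 + t ^ 2, is pi e ^ 2 / c ^ 3, and the integral of e ^ 2 / c ^ 3 in t
    is 2. This is where the constant 2 pi of the Biot-Savart law comes from. *)
Lemma ereal_integral_mollifier e a : 0 < e ->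
  (\int[leb2 R]_y (mollifier e a y)%:E = (2 * pi)%:E)%E.
Proof.
move=> e0; rewrite (plane_tonelli (measurable_mollifier e a) (@mollifier_ge0 e a)).
have pi0 := pi_ge0 R.
transitivity (\int[mu]_t (pi%:E * (e ^+ 2 / Num.sqrt (e ^+ 2 + (t - a.1) ^+ 2) ^+ 3)%:E))%E.
  apply: eq_integral => t _.
  set c := Num.sqrt _.
  have s0 : 0 < e ^+ 2 + (t - a.1) ^+ 2 by exact: sum_sqr_gt0.
  have c0 : 0 < c by rewrite sqrtr_gt0.
  have cE : c ^+ 2 = e ^+ 2 + (t - a.1) ^+ 2 by rewrite sqr_sqrtr// ltW.
  transitivity (\int[mu]_s ((2 * e ^+ 2)%:E * ((c ^+ 2 + (s - a.2) ^+ 2) ^- 2)%:E))%E.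
    by apply: eq_integral => s _; rewrite /mollifier /shifted_sqr /= cE EFinM.
  rewrite ge0_integralZl//; last 3 first.
  - apply/measurable_EFinP/measurable_fun_inv/measurable_funX/measurable_funD => //.
    by apply/measurable_funX/measurable_funB.
  - by move=> s _; rewrite lee_fin invr_ge0 sqr_ge0.
  - by rewrite lee_fin mulr_ge0// sqr_ge0.
  rewrite integral_inv_sum_sqr2// -EFinM -EFinM; congr (_%:E).
  by field; rewrite gt_eqF.
rewrite ge0_integralZl//; last 2 first.
- apply/measurable_EFinP/measurable_funM => //.
  apply/measurable_fun_inv/measurable_funX.
  apply: continuous_measurable_fun => t.
  apply: (@continuous_comp _ _ _ (fun t : R => e ^+ 2 + (t - a.1) ^+ 2) (@Num.sqrt R)).
    apply: cvgD; first exact: cvg_cst.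
    apply: (@continuous_comp _ _ _ (fun t : R => t - a.1) (fun t => t ^+ 2)).
      by apply: cvgB; [exact: cvg_id|exact: cvg_cst].
    exact: exprn_continuous.
  exact: sqrt_continuous.
- by move=> s _; rewrite lee_fin divr_ge0 ?sqr_ge0// exprn_ge0// sqrtr_ge0.
by rewrite integral_inv_sqrt_sum_sqr3// -EFinM mulrC.
Qed.

Lemma plane_integrable_ge0 f : measurable_fun setT f -> (forall y, 0 <= f y) ->
  (\int[leb2 R]_y (f y)%:E < +oo)%E -> plane_integrable f.
Proof.
move=> mf f0 foo; apply/integrableP; split; first exact/measurable_EFinP.
under eq_integral do rewrite /= ger0_norm//.
exact: foo.
Qed.

Lemma plane_integrable_mollifier e a : 0 < e -> plane_integrable (mollifier e a).
Proof.
move=> e0; apply: plane_integrable_ge0; [exact: measurable_mollifier|exact: mollifier_ge0|].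
by rewrite ereal_integral_mollifier// ltry.
Qed.

Lemma integral_mollifier e a : 0 < e -> \int[leb2 R]_y mollifier e a y = 2 * pi.
Proof. by move=> e0; rewrite /Rintegral ereal_integral_mollifier. Qed.

(** Local integrability of the singular kernel without polar coordinates: for fixed
    y.1 the kernel |p| / (p ^ 2 + q ^ 2), with p = y.1 - a.1 and q = y.2 - a.2, is a
    Cauchy density in q of mass pi whatever p != 0 is, so its integral over a vertical
    strip is at most pi times the width. *)
Lemma plane_integrable_kernel1 a L : 0 <= L -> plane_integrable
  (fun y => \1_(`[- L, L]) y.1 * (`|y.1 - a.1| / shifted_sqr 0 a y)).
Proof.
move=> L0.
have mf : measurable_fun setT
    (fun y : R * R => \1_(`[- L, L]) y.1 * (`|y.1 - a.1| / shifted_sqr 0 a y)).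
  apply: measurable_funM.
    apply: (@measurableT_comp _ _ _ _ _ _ (\1_(`[- L, L]) : R -> R) _ (@fst R R)).
      exact: measurable_indic.
    exact: measurable_fst.
  apply: measurable_funM.
    by apply: measurableT_comp => //; exact: smooth_measurable (smooth_shift1 a).
  apply: measurable_fun_inv; exact: measurable_shifted_sqr.
have f0 y : 0 <= (\1_(`[- L, L]) y.1 * (`|y.1 - a.1| / shifted_sqr 0 a y) : R).
  by rewrite mulr_ge0// divr_ge0// shifted_sqr_ge0.
apply: plane_integrable_ge0 => //.
rewrite (plane_tonelli mf f0) /=.
apply: (@le_lt_trans _ _ (\int[mu]_t (pi%:E * (\1_(`[- L, L]) t)%:E))%E).
  apply: ge0_le_integral => //.
  - by move=> t _; apply: integral_ge0 => s _; rewrite lee_fin; exact: (f0 (t, s)).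
  - apply: (@measurable_fun_fubini_tonelli_F _ _ _ _ _ mu (EFin \o
      (fun y => \1_(`[- L, L]) y.1 * (`|y.1 - a.1| / shifted_sqr 0 a y)))).
      exact/measurable_EFinP.
    by move=> y; rewrite lee_fin; exact: f0.
  - by apply/measurable_EFinP/measurable_funM => //; exact: measurable_indic.
  - move=> t _.
    have [->|ta] := eqVneq t a.1.
      rewrite integral0_eq//; last by move=> s _; rewrite subrr normr0 mul0r mulr0.
      by rewrite -EFinM lee_fin mulr_ge0// pi_ge0.
    have c0 : 0 < `|t - a.1| by rewrite normr_gt0 subr_eq0.
    rewrite [leLHS](_ : _ = (\int[mu]_s ((\1_(`[- L, L]) t)%:E *
        (`|t - a.1| / (`|t - a.1| ^+ 2 + (s - a.2) ^+ 2))%:E))%E); last first.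
      apply: eq_integral => s _; rewrite -EFinM /shifted_sqr expr0n add0r /= real_normK//.
      exact: num_real.
    rewrite ge0_integralZl//; last 2 first.
    - apply/measurable_EFinP/measurable_funM => //.
      apply/measurable_fun_inv/measurable_funD => //.
      by apply/measurable_funX/measurable_funB.
    - by move=> s _; rewrite lee_fin divr_ge0// addr_ge0// sqr_ge0.
    by rewrite integral_cauchy// muleC.
rewrite ge0_integralZl//; last 2 first.
- by apply/measurable_EFinP; exact: measurable_indic.
- by rewrite lee_fin pi_ge0.
rewrite integral_indic// setIT. rewrite /= lebesgue_measure_itv /=.
by case: ifP => _; rewrite -?EFinB -?EFinM ?mule0 ltry.
Qed.

Lemma plane_integrable_swap f : plane_integrable f ->
  plane_integrable (fun y => f (y.2, y.1)).
Proof.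
move=> If; have mf := plane_integrable_measurable If.
have ms : measurable_fun setT (fun y : R * R => (y.2, y.1)).
  by apply: measurable_fun_pair; [exact: measurable_snd|exact: measurable_fst].
have mfs : measurable_fun setT (fun y => f (y.2, y.1)).
  exact: (measurableT_comp mf ms).
have mnf : measurable_fun setT (fun y => `|f y|) by exact: measurableT_comp.
apply/integrableP; split; first exact/measurable_EFinP.
have /integrableP[_] := If; apply: le_lt_trans.
rewrite /= (plane_tonelli mnf (fun=> normr_ge0 _)).
rewrite (@fubini_tonelli2 _ _ _ _ _ mu mu (fun y => `|f (y.2, y.1)|%:E))//.
by apply/measurable_EFinP; exact: measurableT_comp.
Qed.

Lemma plane_integrable_kernel2 a L : 0 <= L -> plane_integrable
  (fun y => \1_(`[- L, L]) y.2 * (`|y.2 - a.2| / shifted_sqr 0 a y)).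
Proof.
move=> L0; have := plane_integrable_swap (plane_integrable_kernel1 (a.2, a.1) L0).
rewrite (_ : (fun y => _) = (fun y => \1_(`[- L, L]) y.2 *
  (`|y.2 - a.2| / shifted_sqr 0 a y)))//.
by apply/funext => y; rewrite /shifted_sqr /= addrAC.
Qed.

(** Integrates the lengths of the vertical sections, each covered by two intervals of
    length w. *)
Lemma area_le_of_sections (A : set (R * R)) (L w : R) : 0 <= L -> 0 <= w -> measurable A ->
  (forall y, A y -> `|y.1| <= L) ->
  (forall t, exists b, forall s, A (t, s) -> s \in `[b, b + w] \/ s \in `[- b - w, - b]) ->
  (leb2 R A <= (2 * L * (2 * w))%:E)%E.
Proof.
move=> L0 w0 mA AL Aw.
have bound t : (mu (xsection A t) <= (2 * w)%:E * (\1_(`[- L, L]) t)%:E)%E.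
  have [tL|tL] := boolP (t \in `[- L, L]); last first.
    rewrite (_ : xsection A t = set0) ?measure0; last first.
      apply/seteqP; split => s //=; rewrite /xsection /= inE => /AL /=.
      by rewrite ler_norml => h; move: tL; rewrite in_itv /= h.
    by rewrite mule_ge0// lee_fin// mulr_ge0.
  have [b Ab] := Aw t.
  rewrite indicE mem_set// mule1.
  apply: (@le_trans _ _ (mu (`[b, b + w] `|` `[- b - w, - b]))).
    apply: le_measure; rewrite ?inE.
    - exact: measurable_xsection.
    - exact: measurableU.
    - by move=> s; rewrite /xsection /= inE => /Ab.
  apply: (le_trans (measureU2 _ _ _)) => //.
  rewrite /= !lebesgue_measure_itv /= !lte_fin.
  rewrite mulr_natl mulr2n [leRHS]EFinD; apply: leeD.
    by case: ifP => _; rewrite lee_fin// addrAC subrr add0r.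
  by case: ifP => _; rewrite lee_fin//; lra.
rewrite /product_measure1 /=.
apply: (@le_trans _ _ (\int[mu]_t ((2 * w)%:E * (\1_(`[- L, L]) t)%:E))%E).
  apply: ge0_le_integral => //.
  - exact: measurable_fun_xsection.
  - by apply/measurable_EFinP/measurable_funM => //; exact: measurable_indic.
rewrite ge0_integralZl//; last 2 first.
- by apply/measurable_EFinP; exact: measurable_indic.
- by rewrite lee_fin mulr_ge0.
rewrite integral_indic// setIT /= lebesgue_measure_itv /=.
rewrite lte_fin; case: ifP => _; last by rewrite mule0 lee_fin !mulr_ge0.
by rewrite -EFinB -EFinM lee_fin; lra.
Qed.

End PlaneIntegrals.

(** * Radial cutoffs *)

Section Cutoff.
Context {R : realType}.
Implicit Types (t r : R) (f : R * R -> R) (v y : R * R).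

Lemma flat_ge0 t : 0 <= flat 1 t.
Proof. by rewrite /flat; case: ifP => // _; rewrite hornerE mul1r expR_ge0. Qed.

Lemma flat_gt0 t : 0 < t -> 0 < flat 1 t.
Proof. by rewrite /flat => ->; rewrite hornerE mul1r expR_gt0. Qed.

Lemma flat_eq0 (P : {poly R}) t : t <= 0 -> flat P t = 0.
Proof. by rewrite /flat => t0; rewrite ltNge t0. Qed.

(** Either t or 1 - t is positive, so this sum never vanishes and may serve as a
    denominator. *)
Definition step_den t := flat 1 (1 - t) + flat 1 t.

Lemma step_den_gt0 t : 0 < step_den t.
Proof.
have [t0|t0] := ltP 0 t.
  by rewrite ltr_wpDl ?flat_ge0// flat_gt0.
by rewrite ltr_pwDl ?flat_ge0// flat_gt0// subr_gt0; lra.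
Qed.

(** A smooth transition from 1 on t <= 0 to 0 on t >= 1. *)
Definition step t := flat 1 (1 - t) / step_den t.

Definition dstep t :=
  - (flat (flat_deriv 1) (1 - t) * flat 1 t + flat 1 (1 - t) * flat (flat_deriv 1) t)
    / step_den t ^+ 2.

Lemma step_ge0 t : 0 <= step t.
Proof. by rewrite divr_ge0 ?flat_ge0// ltW// step_den_gt0. Qed.

Lemma step_le1 t : step t <= 1.
Proof. by rewrite ler_pdivrMr ?step_den_gt0// mul1r lerDl flat_ge0. Qed.

Lemma step_eq1 t : t <= 0 -> step t = 1.
Proof.
move=> t0; rewrite /step /step_den (flat_eq0 _ t0) addr0 divff// gt_eqF//.
by apply: flat_gt0; lra.
Qed.

Lemma step_eq0 t : 1 <= t -> step t = 0.
Proof. by move=> t1; rewrite /step flat_eq0 ?mul0r//; lra. Qed.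

Lemma dstep_eq0 t : ~~ (0 < t < 1) -> dstep t = 0.
Proof.
rewrite negb_and -!leNgt /dstep => /orP[t0|t1].
  by rewrite !(flat_eq0 _ t0) !mulr0 addr0 oppr0 mul0r.
have t0 : 1 - t <= 0 by lra.
by rewrite !(flat_eq0 _ t0) !mul0r addr0 oppr0 mul0r.
Qed.

Lemma is_derive_step t : is_derive t 1 step (dstep t).
Proof.
have D1 := is_deriveB (@is_derive_cst _ _ _ (1 : R) t 1) (@is_derive_id _ _ t 1).
have DA := @is_derive1_comp _ (flat 1) (fun t => 1 - t) t _ _ (is_derive_flat 1 _) D1.
have DB := is_derive_flat 1 t.
have DV := @is_deriveV _ _ t _ 1 (lt0r_neq0 (step_den_gt0 t)) (is_deriveD DA DB).
have := is_deriveM DA DV.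
move/is_derive_eq; apply.
rewrite /GRing.scale /= /dstep /step_den.
by field; rewrite gt_eqF// step_den_gt0.
Qed.

Lemma continuous_flat (P : {poly R}) : continuous (flat P).
Proof.
move=> t; apply/differentiable_continuous/derivable1_diffP.
by have [] := is_derive_flat P t.
Qed.

Lemma continuous_dstep : continuous dstep.
Proof.
have cF (P : {poly R}) : continuous (fun t : R => flat P (1 - t)).
  move=> t; apply: (@continuous_comp _ _ _ (fun t : R => 1 - t) (flat P)).
    by apply: cvgB; [exact: cvg_cst|exact: cvg_id].
  exact: continuous_flat.
have cG (P : {poly R}) := @continuous_flat P.
move=> t; apply: cvgM; last first.
  apply: cvgV; first by rewrite expf_neq0// gt_eqF// step_den_gt0.
  apply: (@continuous_comp _ _ _ step_den (fun z => z ^+ 2)).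
    by apply: cvgD; [exact: cF|exact: cG].
  exact: exprn_continuous.
by apply: cvgN; apply: cvgD; apply: cvgM; first [exact: cF|exact: cG].
Qed.

Lemma dstep_bounded : exists2 C : R, 0 <= C & forall t, `|dstep t| <= C.
Proof.
have cn : {within `[0, 1], continuous (fun t => `|dstep t|)}.
  apply: continuous_subspaceT => t; apply: cvg_norm; exact: continuous_dstep.
have [c _ Hc] := EVT_max ler01 cn.
exists `|dstep c| => // t; have [t01|t01] := boolP (0 < t < 1).
  by apply: Hc; rewrite in_itv /=; lra.
by rewrite (dstep_eq0 t01) normr0.
Qed.

Lemma smooth_step_den f : smooth f -> smooth (fun y => step_den (f y)).
Proof.
move=> sf; apply: smoothD; last exact: smooth_flat.
by apply: smooth_flat; apply: smoothB => //; exact: smooth_cst.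
Qed.

Lemma smooth_step f : smooth f -> smooth (fun y => step (f y)).
Proof.
move=> sf; apply: smoothM.
  by apply: smooth_flat; apply: smoothB => //; exact: smooth_cst.
apply: smoothV; last exact: smooth_step_den.
by move=> y; rewrite gt_eqF// step_den_gt0.
Qed.

Definition sqnorm y : R := y.1 ^+ 2 + y.2 ^+ 2.

Lemma smooth_sqnorm : smooth sqnorm.
Proof.
by apply: smoothD; apply: smoothM; first [exact: smooth_fst|exact: smooth_snd].
Qed.

(** Cutting off in the variable |y| ^ 2 keeps the cutoff polynomial in the coordinates
    before it is composed with the transition function; the scale r makes the
    transition happen for r ^ 2 <= |y| ^ 2 <= r ^ 2 + r, an annulus of width about 1 / 2. *)
Definition cutoff_arg r y : R := (sqnorm y - r ^+ 2) / r.

Lemma smooth_cutoff_arg r : smooth (cutoff_arg r).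
Proof.
apply: smoothM; last exact: smooth_cst.
by apply: smoothB; [exact: smooth_sqnorm|exact: smooth_cst].
Qed.

Definition cutoff r y : R := step (cutoff_arg r y).

Lemma smooth_cutoff r : smooth (cutoff r).
Proof. by apply: smooth_step; exact: smooth_cutoff_arg. Qed.

Definition dcutoff r v y : R :=
  dstep (cutoff_arg r y) * (2 * (y.1 * v.1 + y.2 * v.2) / r).

Lemma is_derive_cutoff r v y : is_derive y v (cutoff r) (dcutoff r v y).
Proof.
apply: (@is_derive_comp_line _ step (cutoff_arg r)); first exact: is_derive_step.
have D1 := is_deriveM (is_derive_fst y v) (is_derive_fst y v).
have D2 := is_deriveM (is_derive_snd y v) (is_derive_snd y v).
have := is_deriveM (is_deriveB (is_deriveD D1 D2) (@is_derive_cst _ _ _ (r ^+ 2) y v))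
  (@is_derive_cst _ _ _ (r^-1) y v).
move/is_derive_eq; apply.
by rewrite /GRing.scale /=; ring.
Qed.

Definition annulus r : set (R * R) := [set y | r ^+ 2 <= sqnorm y <= r ^+ 2 + r].

Lemma cutoff_eq1 r y : 0 < r -> sqnorm y <= r ^+ 2 -> cutoff r y = 1.
Proof.
by move=> r0 h; apply: step_eq1; rewrite /cutoff_arg pmulr_lle0 ?invr_gt0// subr_le0.
Qed.

Lemma cutoff_eq0 r y : 0 < r -> r ^+ 2 + r <= sqnorm y -> cutoff r y = 0.
Proof.
by move=> r0 h; apply: step_eq0; rewrite /cutoff_arg ler_pdivlMr// mul1r; lra.
Qed.

Lemma dcutoff_eq0 r v y : 0 < r -> y \notin annulus r -> dcutoff r v y = 0.
Proof.
move=> r0; rewrite notin_setE /annulus /= => h.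
rewrite /dcutoff dstep_eq0 ?mul0r//; apply/negP => /andP[].
rewrite /cutoff_arg ltr_pdivrMr// mul1r pmulr_lgt0 ?invr_gt0// => h1 h2.
by apply: h; apply/andP; split; lra.
Qed.

Lemma sqnorm_coord r y : 1 <= r -> sqnorm y <= r ^+ 2 + r ->
  `|y.1| <= 2 * r /\ `|y.2| <= 2 * r.
Proof.
rewrite /sqnorm => r1 h.
by split; rewrite -ler_sqr ?nnegrE ?mulr_ge0//; try lra; rewrite real_normK ?num_real//; nra.
Qed.

Lemma measurable_annulus r : measurable (annulus r).
Proof.
have -> : annulus r = sqnorm @^-1` `[r ^+ 2, r ^+ 2 + r].
  by apply/seteqP; split => y; rewrite /annulus /= in_itv.
rewrite -[X in measurable X]setTI.
have : measurable_fun setT sqnorm by apply: smooth_measurable; exact: smooth_sqnorm.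
by apply => //; exact: measurable_itv.
Qed.

(** A crude bound: the true area is pi r, but only a bound of order o(r ^ 2) is needed,
    and r ^ (3/2) follows from sqrt (a + r) <= sqrt a + sqrt r on each section. *)
Lemma annulus_area r : 1 <= r ->
  (leb2 R (annulus r) <= (8 * (r * Num.sqrt r))%:E)%E.
Proof.
move=> r1; have r0 : 0 <= r by lra.
have -> : 8 * (r * Num.sqrt r) = 2 * (2 * r) * (2 * Num.sqrt r) by ring.
apply: area_le_of_sections => //; [by rewrite mulr_ge0|exact: measurable_annulus| |].
  by move=> y /andP[_ /(sqnorm_coord r1)[]].
move=> t; set w := Num.sqrt r.
have wE : w ^+ 2 = r by rewrite sqr_sqrtr.
have w0 : 0 <= w by exact: sqrtr_ge0.
(* The square root is 0 when r ^ 2 < t ^ 2; then both intervals start at 0. *)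
pose b := Num.sqrt (r ^+ 2 - t ^+ 2).
have b0 : 0 <= b by exact: sqrtr_ge0.
have bE : b ^+ 2 = Num.max (r ^+ 2 - t ^+ 2) 0.
  rewrite /b; have [h|h] := leP 0 (r ^+ 2 - t ^+ 2).
    by rewrite sqr_sqrtr.
  by rewrite ltr0_sqrtr// expr0n.
exists b => s /andP[]; rewrite /sqnorm /= => h1 h2.
have hb : b <= `|s|.
  rewrite -ler_sqr ?nnegrE// real_normK ?num_real// bE ge_max sqr_ge0 andbT; lra.
have hs : `|s| <= b + w.
  rewrite -ler_sqr ?nnegrE ?addr_ge0// real_normK ?num_real// sqrrD wE bE.
  have : r ^+ 2 - t ^+ 2 <= Num.max (r ^+ 2 - t ^+ 2) 0 by rewrite le_max lexx.
  have : 0 <= b * w *+ 2 by rewrite mulrn_wge0// mulr_ge0.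
  lra.
have [s0|s0] := leP 0 s.
  by left; rewrite in_itv /=; move: hb hs; rewrite ger0_norm// => -> ->.
right; rewrite in_itv /=; move: hb hs; rewrite ltr0_norm// => hb hs.
by apply/andP; split; lra.
Qed.

End Cutoff.

(** * The approximate identity *)

Section Limits.
Context {R : realType}.
Implicit Types (f g h : R * R -> R) (a y : R * R) (e : R).

Definition eps (n : nat) : R := n.+1%:R^-1.

Lemma eps_gt0 n : 0 < eps n.
Proof. by rewrite invr_gt0 ltr0n. Qed.

Lemma eps_le1 n : eps n <= 1.
Proof. by rewrite invf_le1 ?ltr0n// ler1n. Qed.

Lemma eps_cvg0 : eps n @[n --> \oo] --> 0.
Proof. exact: cvg_harmonic. Qed.

(** Away from a the mollifier is O(e ^ 2) times the integrable profile at scale 1, so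
    its tail mass vanishes with e. *)
Lemma mollifier_tail d e a y : 0 < d -> 0 < e -> d ^+ 2 <= (y.1 - a.1) ^+ 2 + (y.2 - a.2) ^+ 2 ->
  mollifier e a y <= e ^+ 2 * ((1 + d ^- 2) ^+ 2 * mollifier 1 a y).
Proof.
move=> d0 e0; rewrite /mollifier /shifted_sqr expr1n -!addrA.
set rho := (_ + _) => hrho.
have d20 : 0 < d ^+ 2 by rewrite exprn_gt0.
have rho0 : 0 < rho by apply: lt_le_trans hrho.
have e20 : 0 < e ^+ 2 by rewrite exprn_gt0.
rewrite ler_pdivrMr; last by rewrite exprn_gt0// addr_gt0.
have k1 : 1 + rho <= (1 + d ^- 2) * rho.
  rewrite mulrDl mul1r addrC lerD2l mulrC ler_pdivlMr// mul1r//.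
have -> : e ^+ 2 * ((1 + d ^- 2) ^+ 2 * (2 * 1 / (1 + rho) ^+ 2)) * (e ^+ 2 + rho) ^+ 2 =
  2 * e ^+ 2 * (((1 + d ^- 2) * (e ^+ 2 + rho)) / (1 + rho)) ^+ 2.
  by field; rewrite !gt_eqF// addr_gt0.
apply: ler_peMr; first by rewrite mulr_ge0// ltW.
apply: exprn_ege1; rewrite ler_pdivlMr; last by rewrite addr_gt0.
rewrite mul1r (le_trans k1)// ler_pM2l; first by rewrite lerDr ltW.
by rewrite addr_gt0// invr_gt0.
Qed.

(** Near a the oscillation of g is small and the mass is 2 pi; far from a the tail bound
    applies. Both cases are combined in one pointwise bound, so no domain is split. *)
Lemma approximate_identity g a (M : R) : measurable_fun setT g ->
  (forall y, `|g y| <= M) -> {for a, continuous g} ->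
  \int[leb2 R]_y (g y * mollifier (eps n) a y) @[n --> \oo] --> 2 * pi * g a.
Proof.
move=> mg gM cg; apply/cvgrPdist_le => eta eta0.
have pi0 := pi_gt0 R.
have M0 : 0 <= M by apply: le_trans (gM a).
(* The mass 2 pi of the mollifier turns eta1 into eta / 2. *)
pose eta1 := eta / (4 * pi).
have eta10 : 0 < eta1 by rewrite divr_gt0// mulr_gt0.
have /nbhs_ballP[d /= d0 Hd] : \forall y \near a, `|g a - g y| <= eta1.
  by move/cvgrPdist_le : cg; apply.
pose C := (1 + d ^- 2) ^+ 2.
have C0 : 0 <= C by rewrite sqr_ge0.
have key n y : `|(g y - g a) * mollifier (eps n) a y| <=
    eta1 * mollifier (eps n) a y + 2 * M * (eps n ^+ 2 * C) * mollifier 1 a y.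
  have b0 := mollifier_ge0 (eps n) a y; have b10 := mollifier_ge0 1 a y.
  rewrite normrM (ger0_norm b0).
  have [hy|hy] := leP (d ^+ 2) ((y.1 - a.1) ^+ 2 + (y.2 - a.2) ^+ 2).
    have := mollifier_tail d0 (eps_gt0 n) hy; rewrite -/C => ht.
    apply: (@le_trans _ _ (2 * M * mollifier (eps n) a y)).
      rewrite ler_wpM2r// (le_trans (ler_normB _ _))//.
      by have := gM y; have := gM a; lra.
    rewrite -[X in X <= _]add0r; apply: lerD.
      by apply: mulr_ge0 => //; exact: ltW.
    by rewrite -(mulrA (2 * M)) -(mulrA (eps n ^+ 2)) ler_wpM2l// mulr_ge0.
  rewrite -[X in X <= _]addr0; apply: lerD; last first.
    by do 2?apply: mulr_ge0 => //; [exact: mulr_ge0|apply: mulr_ge0 => //; exact: sqr_ge0].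
  rewrite ler_wpM2r// distrC; apply: Hd.
  have d1 : (y.1 - a.1) ^+ 2 < d ^+ 2 by apply: le_lt_trans hy; rewrite lerDl sqr_ge0.
  have d2 : (y.2 - a.2) ^+ 2 < d ^+ 2 by apply: le_lt_trans hy; rewrite lerDr sqr_ge0.
  split; rewrite /ball /= distrC -ltr_sqr ?nnegrE ?(ltW d0)//;
    by rewrite real_normK ?num_real.
have Ib n : plane_integrable (mollifier (eps n) a) by exact/plane_integrable_mollifier/eps_gt0.
have Ib1 : plane_integrable (mollifier 1 a) by exact: plane_integrable_mollifier.
have Igb n : plane_integrable (fun y => g y * mollifier (eps n) a y).
  apply: (plane_integrable_le _ _ (plane_integrableZ M (Ib n))).
    by apply: measurable_funM => //; exact: measurable_mollifier.
  by move=> y; rewrite normrM (ger0_norm (mollifier_ge0 _ _ _)) ler_wpM2r ?mollifier_ge0.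
have K00 : 0 <= 4 * pi * M * C.
  by do 3?apply: mulr_ge0 => //; exact: ltW.
have est n : `|2 * pi * g a - \int[leb2 R]_y (g y * mollifier (eps n) a y)| <=
   eta / 2 + 4 * pi * M * C * eps n.
  rewrite distrC mulrC -(integral_mollifier a (eps_gt0 n)) -RintegralZl//; last exact: Ib.
  rewrite -RintegralB//; [|exact: Igb|exact: (plane_integrableZ (g a) (Ib n))].
  rewrite (_ : \int[leb2 R]_y _ = \int[leb2 R]_y ((g y - g a) * mollifier (eps n) a y)); last first.
    by apply: eq_Rintegral => y _; rewrite mulrBl.
  have I1 := plane_integrableZ eta1 (Ib n).
  have I2 := plane_integrableZ (2 * M * (eps n ^+ 2 * C)) Ib1.
  apply: le_trans (norm_integral_le _ (key n) (plane_integrableD I1 I2)) _.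
    apply: measurable_funM; last exact: measurable_mollifier.
    exact: measurable_funB.
  rewrite RintegralD//.
  rewrite (RintegralZl _ measurableT (Ib n)) (RintegralZl _ measurableT Ib1).
  rewrite !integral_mollifier ?eps_gt0// /eta1 lerD//.
    rewrite le_eqVlt; apply/orP; left; apply/eqP; move: (pi : R) pi0 => p p0.
    by field; rewrite gt_eqF.
  have e1 : eps n ^+ 2 <= eps n by rewrite expr2 ger_pMl ?eps_gt0// eps_le1.
  have -> : 2 * M * (eps n ^+ 2 * C) * (2 * pi) = 4 * pi * M * C * eps n ^+ 2 by ring.
  by apply: ler_wpM2l => //; exact: K00.
have K0 : 0 < 4 * pi * M * C + 1.
  by rewrite ltr_wpDl//; exact: K00.
have d20 : 0 < eta / 2 / (4 * pi * M * C + 1) by rewrite divr_gt0//; lra.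
have en : \forall n \near \oo, `|eps n| <= eta / 2 / (4 * pi * M * C + 1).
  by have /cvgr0_norm_le := eps_cvg0; apply.
near=> n; apply: le_trans (est n) _.
suff : 4 * pi * M * C * eps n <= eta / 2 by lra.
have : eps n <= eta / 2 / (4 * pi * M * C + 1).
  by rewrite -[leLHS](ger0_norm (ltW (eps_gt0 n))); near: n.
rewrite ler_pdivlMr// mulrDr mulr1; have := eps_gt0 n.
move: (4 * pi * M * C) => k; lra.
Unshelve. all: by end_near. Qed.

End Limits.

(** * Regularized kernels and the weak equations *)

Section KernelLimit.
Context {R : realType}.
Implicit Types (f g h N G : R * R -> R) (a y : R * R) (e L : R).

Lemma shifted_sqrE e a y : shifted_sqr e a y = e ^+ 2 + shifted_sqr 0 a y.
Proof. by rewrite /shifted_sqr expr0n add0r addrA. Qed.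

(** Regularizing only increases the denominator. Where the singular denominator
    vanishes the quotient is 0 by the convention 0^-1 = 0, and the hypothesis on N keeps
    the regularized quotient equal to 0 there as well. *)
Lemma kernel_regularized_le N e a y : (shifted_sqr 0 a y = 0 -> N y = 0) ->
  `|N y / shifted_sqr e a y| <= `|N y / shifted_sqr 0 a y|.
Proof.
move=> N0; have [s0|s0] := eqVneq (shifted_sqr 0 a y) 0.
  by rewrite (N0 s0) !mul0r.
have s1 : 0 < shifted_sqr 0 a y by rewrite lt0r s0 shifted_sqr_ge0.
rewrite !normrM ler_wpM2l// !normfV lef_pV2 ?posrE ?normr_gt0//.
  rewrite !ger0_norm ?shifted_sqr_ge0// [leRHS]shifted_sqrE lerDr sqr_ge0//.
by rewrite gt_eqF// shifted_sqrE ltr_wpDl// sqr_ge0.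
Qed.

Lemma measurable_regularized N e a : measurable_fun setT N ->
  measurable_fun setT (fun y => N y / shifted_sqr e a y).
Proof.
move=> mN; apply: measurable_funM => //.
by apply: measurable_fun_inv; exact: measurable_shifted_sqr.
Qed.

Lemma integrable_regularized h N G e a : measurable_fun setT h -> measurable_fun setT N ->
  (forall y, shifted_sqr 0 a y = 0 -> N y = 0) ->
  plane_integrable G -> (forall y, `|h y * (N y / shifted_sqr 0 a y)| <= G y) ->
  plane_integrable (fun y => h y * (N y / shifted_sqr e a y)).
Proof.
move=> mh mN N0 IG hG; apply: plane_integrable_le IG.
  by apply: measurable_funM => //; exact: measurable_regularized.
move=> y; apply: le_trans (hG y); rewrite !(normrM (h y)) ler_wpM2l//.
by apply: kernel_regularized_le; exact: N0.
Qed.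

(** Dominated convergence: the singular integrand bounds all the regularized ones. *)
Lemma integral_regularized_cvg h N G a : measurable_fun setT h -> measurable_fun setT N ->
  (forall y, shifted_sqr 0 a y = 0 -> N y = 0) ->
  plane_integrable G -> (forall y, `|h y * (N y / shifted_sqr 0 a y)| <= G y) ->
  \int[leb2 R]_y (h y * (N y / shifted_sqr (eps n) a y)) @[n --> \oo] -->
  \int[leb2 R]_y (h y * (N y / shifted_sqr 0 a y)).
Proof.
move=> mh mN N0 IG hG.
have I0 := @integrable_regularized _ _ _ 0 _ mh mN N0 IG hG.
apply: fine_cvg; rewrite fineK; last exact: integrable_fin_num.
apply: (@dominated_cvg _ _ _ (leb2 R) setT measurableT _ _ (EFin \o G)) => //.
- move=> n; apply/measurable_EFinP; apply: measurable_funM => //.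
  exact: measurable_regularized.
- move=> y _; apply: cvg_EFin; first by near=> n.
  apply: cvgM; first exact: cvg_cst.
  have [s0|s0] := eqVneq (shifted_sqr 0 a y) 0.
    by rewrite (N0 _ s0); under eq_fun do rewrite mul0r; rewrite mul0r; exact: cvg_cst.
  apply: cvgM; first exact: cvg_cst.
  apply: cvgV => //.
  rewrite [in X in _ --> X]shifted_sqrE.
  under eq_fun do rewrite shifted_sqrE.
  apply: cvgD; last exact: cvg_cst.
  apply: (@cvg_comp _ _ _ (@eps R) (fun z : R => z ^+ 2)); first exact: eps_cvg0.
  exact: exprn_continuous.
- move=> n y _; rewrite lee_fin; apply: le_trans (hG y).
  rewrite !(normrM (h y)) ler_wpM2l//.
  by apply: kernel_regularized_le; exact: N0.
Unshelve. all: by end_near. Qed.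

(** A continuous function is bounded on the closed box that contains its support. *)
Lemma compactly_supported_integrable f L : 0 <= L -> continuous f ->
  (forall y, f y != 0 -> `|y.1| <= L /\ `|y.2| <= L) -> plane_integrable f.
Proof.
move=> L0 cf fL.
pose B : set (R * R) := `[- L, L] `*` `[- L, L].
have mB : measurable B by apply: measurableX; exact: measurable_itv.
have B0 : B !=set0 by exists (0, 0); split; rewrite /= in_itv /= oppr_le0 L0.
have cn : {within B, continuous (fun y => `|f y|)}.
  by apply: continuous_subspaceT => y; apply: cvg_norm; exact: cf.
have [c _ Hc] := compact_EVT_max B0 (compact_box (L:=L)) cn.
have IB : plane_integrable \1_B.
  apply: plane_integrable_ge0; [exact: measurable_indic|by []|].
  rewrite integral_indic// setIT.
  rewrite [X in (X < _)%E](@product_measure1E _ _ _ _ _ (@lebesgue_measure R) (@lebesgue_measure R))//.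
  rewrite /= !lebesgue_measure_itv /=.
  by case: ifP => _; rewrite ?mule0 -?EFinM ltry.
apply: plane_integrable_le (plane_integrableZ `|f c| IB).
  exact: continuous_measurable_plane.
move=> y; rewrite indicE; have [yB|yB] := boolP (y \in B).
  by rewrite mulr1; exact: Hc.
rewrite mulr0 normr_le0; apply: contraNT yB => /fL[h1 h2].
by rewrite inE; split; rewrite /= in_itv /= -ler_norml.
Qed.

End KernelLimit.

Section WeakIdentity.
Context {R : realType}.
Variables (u : R * R -> R * R) (omega : R * R -> R).
Hypothesis div_u : distr_eq (div u) (fun=> 0).
Hypothesis curl_u : distr_eq (curl u) (distr_of omega).
Variable M : R.
Hypothesis mu1 : measurable_fun setT (fun y => (u y).1).
Hypothesis mu2 : measurable_fun setT (fun y => (u y).2).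
Hypothesis uM1 : forall y, `|(u y).1| <= M.
Hypothesis uM2 : forall y, `|(u y).2| <= M.

Lemma smooth_of_is_derive (f d : R * R -> R) v : smooth f ->
  (forall y, is_derive y v f (d y)) -> smooth d.
Proof.
move=> sf D; have [d' sd' D'] := smooth_derive v sf.
rewrite (_ : d = d')//; apply/funext => y.
by have [_ <-] := D y; have [_ <-] := D' y.
Qed.

Lemma integrable_bounded_mul (w d : R * R -> R) : measurable_fun setT w ->
  (forall y, `|w y| <= M) -> plane_integrable d -> plane_integrable (fun y => w y * d y).
Proof.
move=> mw wM Id.
have Ind : plane_integrable (fun y => `|d y|).
  apply: plane_integrable_ge0 => //.
    by apply: measurableT_comp => //; exact: plane_integrable_measurable.
  by have /integrableP[_] := Id.
apply: plane_integrable_le (plane_integrableZ M Ind).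
  by apply: measurable_funM => //; exact: plane_integrable_measurable.
by move=> y; rewrite normrM ler_wpM2r.
Qed.

(** The equation div u = 0 tested against V1, plus curl u = omega tested against V2: in
    complex notation, the real part of the d-bar equation for u.1 - i u.2 tested against
    V1 - i V2. *)
Lemma weak_div_curl (V1 V2 d11 d12 d21 d22 : R * R -> R) (L : R) : 0 <= L ->
  smooth V1 -> smooth V2 ->
  (forall y, is_derive y e1 V1 (d11 y)) -> (forall y, is_derive y e1 V2 (d12 y)) ->
  (forall y, is_derive y e2 V1 (d21 y)) -> (forall y, is_derive y e2 V2 (d22 y)) ->
  (forall y, ~ (`|y.1| <= L /\ `|y.2| <= L) ->
     [/\ V1 y = 0, V2 y = 0, d11 y = 0, d12 y = 0 & d21 y = 0 /\ d22 y = 0]) ->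
  \int[leb2 R]_y ((u y).1 * (d11 y + d22 y) + (u y).2 * (d21 y - d12 y)) =
  \int[leb2 R]_y (omega y * V2 y).
Proof.
move=> L0 sV1 sV2 D11 D12 D21 D22 supp.
have box (f : R * R -> R) : (forall y, ~ (`|y.1| <= L /\ `|y.2| <= L) -> f y = 0) ->
    forall y, f y != 0 -> `|y.1| <= L /\ `|y.2| <= L.
  by move=> f0 y; apply: contra_neqP => /f0.
have T1 : test_function V1.
  by apply: (@smooth_test_function _ _ L) => //; apply: box => y /supp[].
have T2 : test_function V2.
  by apply: (@smooth_test_function _ _ L) => //; apply: box => y /supp[].
have I (f d : R * R -> R) (v : R * R) : smooth f -> (forall y, is_derive y v f (d y)) ->
    (forall y, ~ (`|y.1| <= L /\ `|y.2| <= L) -> d y = 0) -> plane_integrable d.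
  move=> sf D d0; apply: (compactly_supported_integrable L0); last exact: box.
  exact/smooth_continuous/(smooth_of_is_derive sf D).
have I11 : plane_integrable d11 by apply: (I V1 _ e1) => // y /supp[].
have I12 : plane_integrable d12 by apply: (I V2 _ e1) => // y /supp[].
have I21 : plane_integrable d21 by apply: (I V1 _ e2) => // y /supp[_ _ _ _ []].
have I22 : plane_integrable d22 by apply: (I V2 _ e2) => // y /supp[_ _ _ _ []].
have DE (f d : R * R -> R) (v : R * R) : (forall y, is_derive y v f (d y)) ->
    (fun y => 'D_v f y) = d.
  by move=> D; apply/funext => y; have [_ <-] := D y.
have := div_u T1; have := curl_u T2.
rewrite /div /curl /distr_partial.
rewrite (DE V1 d11 e1 D11) (DE V2 d12 e1 D12) (DE V1 d21 e2 D21) (DE V2 d22 e2 D22).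
rewrite /distr_of => <- dv.
have J11 := integrable_bounded_mul mu1 uM1 I11.
have J22 := integrable_bounded_mul mu1 uM1 I22.
have J12 := integrable_bounded_mul mu2 uM2 I12.
have J21 := integrable_bounded_mul mu2 uM2 I21.
have -> : \int[leb2 R]_y ((u y).1 * (d11 y + d22 y) + (u y).2 * (d21 y - d12 y)) =
  \int[leb2 R]_y (((u y).1 * d11 y + (u y).1 * d22 y) +
    ((u y).2 * d21 y - (u y).2 * d12 y)).
  by apply: eq_Rintegral => y _; ring.
rewrite RintegralD//; last 2 first.
- exact: plane_integrableD J11 J22.
- by have := integrableB measurableT J21 J12.
rewrite (RintegralD measurableT J11 J22) (RintegralB measurableT J21 J12).
by lra.
Qed.

End WeakIdentity.

(** * The Biot-Savart kernel and its dipole *)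

Section Kernel.
Context {R : realType}.
Implicit Types (i : bool) (a x y v : R * R) (e r L W : R) (h : R * R -> R).

(** Selecting the coordinate by a boolean lets one argument treat both components of
    the kernel. *)
Definition coord i y : R := if i then y.1 else y.2.

(** Component i of (y - a) / (e ^ 2 + |y - a| ^ 2), the gradient in y of half of
    ln (e ^ 2 + |y - a| ^ 2). *)
Definition kernel i e a y : R := (coord i y - coord i a) / shifted_sqr e a y.

Definition dkernel i e a v y : R := coord i v / shifted_sqr e a y -
  (coord i y - coord i a) *
  (2 * ((y.1 - a.1) * v.1 + (y.2 - a.2) * v.2)) / shifted_sqr e a y ^+ 2.

Lemma smooth_coord i a : smooth (fun y => coord i y - coord i a).
Proof. by case: i; [exact: smooth_shift1|exact: smooth_shift2]. Qed.

Lemma is_derive_coord i a v y : is_derive y v (fun y => coord i y - coord i a) (coord i v).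
Proof.
case: i; rewrite /coord.
  have := is_deriveB (is_derive_fst y v) (@is_derive_cst _ _ _ a.1 y v).
  by move/is_derive_eq; apply; rewrite subr0.
have := is_deriveB (is_derive_snd y v) (@is_derive_cst _ _ _ a.2 y v).
by move/is_derive_eq; apply; rewrite subr0.
Qed.

Lemma coord_sqr_le i e a y : (coord i y - coord i a) ^+ 2 <= shifted_sqr e a y.
Proof.
rewrite /shifted_sqr; have := sqr_ge0 e; have := sqr_ge0 (y.1 - a.1).
by have := sqr_ge0 (y.2 - a.2); case: i; rewrite /coord; lra.
Qed.

Lemma coord_eq0 i a y : shifted_sqr 0 a y = 0 -> coord i y - coord i a = 0.
Proof.
move=> s0; apply/eqP; rewrite -sqrf_eq0 eq_le sqr_ge0 andbT -s0.
exact: coord_sqr_le.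
Qed.

Lemma measurable_coord i a : measurable_fun setT (fun y => coord i y - coord i a).
Proof. by apply: smooth_measurable; exact: smooth_coord. Qed.

Lemma measurable_kernel i e a : measurable_fun setT (kernel i e a).
Proof. by apply: measurable_regularized; exact: measurable_coord. Qed.

Lemma smooth_kernel i e a : 0 < e -> smooth (kernel i e a).
Proof.
move=> e0; apply: smoothM; first exact: smooth_coord.
apply: smoothV; last exact: smooth_shifted_sqr.
by move=> y; rewrite gt_eqF// shifted_sqr_gt0.
Qed.

Lemma is_derive_kernel i e a v y : 0 < e ->
  is_derive y v (kernel i e a) (dkernel i e a v y).
Proof.
move=> e0; have s0 := shifted_sqr_gt0 a y e0.
have D1 := is_derive_coord true a v y.
have D2 := is_derive_coord false a v y.
have DS := is_deriveD (is_deriveD (@is_derive_cst _ _ _ (e ^+ 2) y v) (is_deriveM D1 D1))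
  (is_deriveM D2 D2).
have DV := @is_derive_comp_line _ (fun t => t^-1) (shifted_sqr e a) y v _ _
  (@is_deriveV _ id _ _ _ (lt0r_neq0 s0) (is_derive_id _ _)) DS.
have := is_deriveM (is_derive_coord i a v y) DV.
move/is_derive_eq; apply.
rewrite /GRing.scale /dkernel /=.
move: s0; set S := shifted_sqr e a y => s0.
by field; rewrite gt_eqF.
Qed.

Lemma div_kernel e a y : 0 < e ->
  dkernel true e a e1 y + dkernel false e a e2 y = mollifier e a y.
Proof.
move=> e0; have s0 := shifted_sqr_gt0 a y e0.
rewrite /dkernel /mollifier /coord /e1 /e2 /=.
have -> : e ^+ 2 = shifted_sqr e a y - (y.1 - a.1) ^+ 2 - (y.2 - a.2) ^+ 2.
  by rewrite /shifted_sqr; ring.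
by field; rewrite gt_eqF.
Qed.

(** The kernel is a gradient, so its mixed derivatives agree. *)
Lemma curl_kernel e a y : dkernel true e a e2 y = dkernel false e a e1 y.
Proof. by rewrite /dkernel /coord /e1 /e2 /=; congr (_ - _ / _); ring. Qed.

Lemma integrable_kernel_dominator i a L : 0 <= L -> plane_integrable
  (fun y => \1_(`[- L, L]) (coord i y) * (`|coord i y - coord i a| / shifted_sqr 0 a y)).
Proof.
by case: i; [exact: plane_integrable_kernel1|exact: plane_integrable_kernel2].
Qed.

Lemma kernel_dominated i a L W h y : 0 <= L -> 0 <= W -> `|h y| <= W ->
  (h y != 0 -> `|coord i y| <= L) ->
  `|h y * kernel i 0 a y| <=
    W * (\1_(`[- L, L]) (coord i y) * (`|coord i y - coord i a| / shifted_sqr 0 a y)).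
Proof.
move=> L0 W0 hW hL; have [->|h0] := eqVneq (h y) 0.
  by rewrite mul0r normr0 !mulr_ge0// ?invr_ge0 ?shifted_sqr_ge0.
rewrite indicE mem_set ?mul1r; last by rewrite /= in_itv /= -ler_norml hL.
rewrite normrM ler_pM// /kernel normrM normfV (ger0_norm (shifted_sqr_ge0 _ _ _))//.
Qed.

Lemma integrable_mul_kernel i e a L W h : 0 <= L -> 0 <= W -> measurable_fun setT h ->
  (forall y, `|h y| <= W) -> (forall y, h y != 0 -> `|coord i y| <= L) ->
  plane_integrable (fun y => h y * kernel i e a y).
Proof.
move=> L0 W0 mh hW hL.
apply: (integrable_regularized _ mh (measurable_coord i a) (@coord_eq0 i a)
  (plane_integrableZ W (integrable_kernel_dominator i a L0))) => y.
by apply: kernel_dominated => //; exact: hL.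
Qed.

Lemma integral_mul_kernel_cvg i a L W h : 0 <= L -> 0 <= W -> measurable_fun setT h ->
  (forall y, `|h y| <= W) -> (forall y, h y != 0 -> `|coord i y| <= L) ->
  \int[leb2 R]_y (h y * kernel i (eps n) a y) @[n --> \oo] -->
  \int[leb2 R]_y (h y * kernel i 0 a y).
Proof.
move=> L0 W0 mh hW hL.
apply: (integral_regularized_cvg mh (measurable_coord i a) (@coord_eq0 i a)
  (plane_integrableZ W (integrable_kernel_dominator i a L0))) => y.
by apply: kernel_dominated => //; exact: hL.
Qed.

(** Subtracting the kernel centred at the origin gains one order of decay at infinity,
    which is what makes the boundary terms vanish for a merely bounded velocity. *)
Definition dipole i e x y : R := kernel i e x y - kernel i e 0 y.

(** Over the common denominator, the numerator is
    - x_i (e ^ 2 + |y| ^ 2) + y_i (2 x.y - |x| ^ 2), at most 4 |x| (e ^ 2 + |y| ^ 2) in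
    size, while e ^ 2 + |y - x| ^ 2 >= r ^ 2 / 2 when |y| >= r >= 4 |x|. The bound is
    uniform in e, so it survives the removal of the regularization. *)
Lemma dipole_le i e x y r : 0 < r -> 4 * (`|x.1| + `|x.2|) <= r -> r ^+ 2 <= sqnorm y ->
  `|dipole i e x y| <= 8 * (`|x.1| + `|x.2|) / r ^+ 2.
Proof.
move=> r0 xr ry; set X := _ + _ in xr *.
have X0 : 0 <= X by rewrite addr_ge0.
pose rho := Num.sqrt (sqnorm y).
have sq0 : 0 <= sqnorm y by rewrite /sqnorm addr_ge0 ?sqr_ge0.
have rho2 : rho ^+ 2 = sqnorm y by rewrite sqr_sqrtr.
have rho0 : 0 <= rho by exact: sqrtr_ge0.
have rr : r <= rho by rewrite -ler_sqr ?nnegrE ?(ltW r0)// rho2.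
have y1 : `|y.1| <= rho.
  by rewrite -ler_sqr ?nnegrE// real_normK ?num_real// rho2 lerDl sqr_ge0.
have y2 : `|y.2| <= rho.
  by rewrite -ler_sqr ?nnegrE// real_normK ?num_real// rho2 lerDr sqr_ge0.
have yi : `|coord i y| <= rho by case: (i).
have xi : `|coord i x| <= X by rewrite /X; case: (i); rewrite ?lerDl ?lerDr.
pose ip := x.1 * y.1 + x.2 * y.2.
have ipX : `|ip| <= X * rho.
  rewrite (le_trans (ler_normD _ _))// !normrM mulrDl lerD// ler_wpM2l//.
have x2X : x.1 ^+ 2 + x.2 ^+ 2 <= X ^+ 2.
  rewrite /X sqrrD -(real_normK (num_real x.1)) -(real_normK (num_real x.2)).
  have : 0 <= `|x.1| * `|x.2| *+ 2 by rewrite mulrn_wge0// mulr_ge0.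
  lra.
have x20 : 0 <= x.1 ^+ 2 + x.2 ^+ 2 by rewrite addr_ge0// sqr_ge0.
have [ip1 ip2] : - (X * rho) <= ip /\ ip <= X * rho.
  by move: ipX; rewrite ler_norml => /andP.
have Xrho : 4 * (X * rho) <= rho ^+ 2.
  by rewrite expr2 mulrA ler_wpM2r//; lra.
have X2rho : 4 * X ^+ 2 <= X * rho by rewrite expr2 mulrCA ler_wpM2l//; lra.
have e0 := sqr_ge0 e.
have S0E : shifted_sqr e 0 y = e ^+ 2 + rho ^+ 2.
  by rewrite /shifted_sqr rho2 /sqnorm /= !subr0 addrA.
have SxE : shifted_sqr e x y = e ^+ 2 + rho ^+ 2 - (2 * ip - (x.1 ^+ 2 + x.2 ^+ 2)).
  by rewrite /shifted_sqr rho2 /sqnorm /ip; ring.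
have rho20 : 0 < rho ^+ 2 by rewrite exprn_gt0//; lra.
have Sx : rho ^+ 2 / 2 <= shifted_sqr e x y by rewrite SxE; lra.
have S0 : rho ^+ 2 <= shifted_sqr e 0 y by rewrite S0E; lra.
have -> : dipole i e x y = (- coord i x * shifted_sqr e 0 y +
    coord i y * (2 * ip - (x.1 ^+ 2 + x.2 ^+ 2))) /
    (shifted_sqr e x y * shifted_sqr e 0 y).
  have -> : 2 * ip - (x.1 ^+ 2 + x.2 ^+ 2) = shifted_sqr e 0 y - shifted_sqr e x y.
    by rewrite S0E SxE; ring.
  rewrite /dipole /kernel; have -> : coord i (0 : R * R) = 0 by case: (i).
  by field; rewrite !gt_eqF//; lra.
have P0 : 0 < shifted_sqr e x y * shifted_sqr e 0 y by rewrite mulr_gt0//; lra.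
rewrite normrM normfV (gtr0_norm P0) ler_pdivrMr//.
apply: (@le_trans _ _ (4 * X * shifted_sqr e 0 y)).
  rewrite (le_trans (ler_normD _ _))// !normrM normrN.
  have h1 : `|coord i x| * `|shifted_sqr e 0 y| <= X * shifted_sqr e 0 y.
    by rewrite (ger0_norm (shifted_sqr_ge0 _ _ _)) ler_wpM2r// shifted_sqr_ge0.
  have h2 : `|2 * ip - (x.1 ^+ 2 + x.2 ^+ 2)| <= 3 * (X * rho).
    by rewrite ler_norml; apply/andP; split; lra.
  have h3 : `|coord i y| * `|2 * ip - (x.1 ^+ 2 + x.2 ^+ 2)| <= rho * (3 * (X * rho)).
    by rewrite ler_pM.
  have h4 : rho * (3 * (X * rho)) <= 3 * X * shifted_sqr e 0 y.
    have -> : rho * (3 * (X * rho)) = 3 * X * rho ^+ 2 by ring.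
    by rewrite ler_wpM2l// mulr_ge0.
  have -> : 4 * X * shifted_sqr e 0 y = X * shifted_sqr e 0 y + 3 * X * shifted_sqr e 0 y by ring.
  lra.
rewrite (mulrA (8 * X / _)) ler_wpM2r ?shifted_sqr_ge0//.
have -> : 4 * X = 8 * X / r ^+ 2 * (r ^+ 2 / 2) by field; rewrite gt_eqF.
rewrite ler_wpM2l//; first by apply: divr_ge0; [exact: mulr_ge0|exact: sqr_ge0].
by rewrite -rho2 in ry; lra.
Qed.

End Kernel.

(** * From the regularized identity to an estimate on a disc *)

Section Estimate.
Context {R : realType}.
Implicit Types (i : bool) (x y : R * R) (r : R).

Lemma integral_annulus_le r : 1 <= r ->
  plane_integrable (\1_(annulus r) : R * R -> R) /\
  \int[leb2 R]_y (\1_(annulus r) y : R) <= 8 * (r * Num.sqrt r).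
Proof.
move=> r1; have A := annulus_area r1.
have mA := @measurable_annulus R r.
have I : (\int[leb2 R]_y (\1_(annulus r) y : R)%:E <= (8 * (r * Num.sqrt r))%:E)%E.
  by rewrite integral_indic// setIT.
split.
  apply: plane_integrable_ge0; [exact: measurable_indic|by []|].
  by apply: le_lt_trans I _; rewrite ltry.
rewrite /Rintegral -lee_fin fineK//.
rewrite ge0_fin_numE; first by apply: le_lt_trans I _; rewrite ltry.
by apply: integral_ge0 => y _; rewrite lee_fin.
Qed.

Lemma integral_sub_annulus_le (f g : R * R -> R) (E r : R) : 1 <= r -> 0 <= E ->
  plane_integrable f -> plane_integrable g ->
  (forall y, `|f y - g y| <= E * \1_(annulus r) y) ->
  `|\int[leb2 R]_y f y - \int[leb2 R]_y g y| <= E * (8 * (r * Num.sqrt r)).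
Proof.
move=> r1 E0 If Ig fg; have [IA IAle] := integral_annulus_le r1.
rewrite -(RintegralB measurableT If Ig).
apply: le_trans (norm_integral_le _ fg (plane_integrableZ E IA)) _.
  by apply: measurable_funB; exact: plane_integrable_measurable.
by rewrite (RintegralZl _ measurableT IA) ler_wpM2l.
Qed.

Lemma norm_cutoff_le1 r y : `|cutoff r y| <= 1.
Proof. by rewrite ger0_norm ?step_ge0// step_le1. Qed.

Lemma cutoff_neq0_coord i r y : 1 <= r -> cutoff r y != 0 -> `|coord i y| <= 2 * r.
Proof.
move=> r1 c0; have [|h] := leP (sqnorm y) (r ^+ 2 + r).
  by move/(sqnorm_coord r1) => []; case: i.
by move: c0; rewrite cutoff_eq0 ?eqxx// ?ltW//; lra.
Qed.

Lemma edisc_indicE r y : 0 <= r -> (\1_(edisc r) y : R) = (sqnorm y <= r ^+ 2)%R%:R.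
Proof.
move=> r0; rewrite indicE; congr (nat_of_bool _)%:R.
apply/idP/idP; rewrite inE /edisc /= /enorm -/(sqnorm y) => h.
  by rewrite -(@sqr_sqrtr _ (sqnorm y)) ?addr_ge0 ?sqr_ge0// ler_sqr ?nnegrE ?sqrtr_ge0.
by rewrite -[r]ger0_norm// -sqrtr_sqr ler_wsqrtr.
Qed.

Lemma measurable_edisc r : 0 <= r -> measurable (edisc r : set (R * R)).
Proof.
move=> r0.
have -> : edisc r = sqnorm @^-1` `]-oo, r ^+ 2].
  apply/seteqP; split => y; rewrite /= in_itv /=;
    have := @edisc_indicE r y r0; rewrite indicE => h H.
    by move: h; rewrite mem_set//; case: (_ <= _) => // /eqP; rewrite oner_eq0.
  by move: h; rewrite H; have [/set_mem//|_ /eqP] := boolP (y \in edisc r); rewrite eq_sym oner_eq0.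
rewrite -[X in measurable X]setTI.
have : measurable_fun setT (@sqnorm R).
  by apply: smooth_measurable; exact: smooth_sqnorm.
by apply => //; exact: measurable_itv.
Qed.

Lemma disc_cutoff_diff r y : 0 < r -> y \notin annulus r -> \1_(edisc r) y - cutoff r y = 0.
Proof.
move=> r0; rewrite notin_setE /annulus /= => h.
rewrite (edisc_indicE _ (ltW r0)); have [h1|h1] := leP (sqnorm y) (r ^+ 2).
  by rewrite cutoff_eq1// subrr.
have -> : cutoff r y = 0.
  apply: cutoff_eq0 => //; rewrite leNgt; apply/negP => h2.
  by apply: h; rewrite (ltW h1) (ltW h2).
by rewrite subr0.
Qed.

Section DipoleEstimate.
Variables (w om : R * R -> R) (M W : R) (i : bool) (x : R * R) (r E : R).
Variable err : nat -> R * R -> R.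
Hypothesis (cw : continuous w) (wM : forall y, `|w y| <= M).
Hypothesis (mom : measurable_fun setT om) (omW : forall y, `|om y| <= W).
Hypothesis (r1 : 1 <= r) (xr : 4 * (`|x.1| + `|x.2|) <= r).
Hypothesis merr : forall n, measurable_fun setT (err n).
Hypothesis (E0 : 0 <= E) (errE : forall n y, `|err n y| <= E * \1_(annulus r) y).
Hypothesis identity : forall n,
  \int[leb2 R]_y (w y * (cutoff r y * (mollifier (eps n) x y - mollifier (eps n) 0 y)) + err n y) =
  \int[leb2 R]_y (om y * (cutoff r y * dipole i (eps n) x y)).

Let r0 : 0 < r. Proof. exact: lt_le_trans ltr01 r1. Qed.
Let W0 : 0 <= W. Proof. exact: le_trans (omW 0). Qed.

Let X := `|x.1| + `|x.2|.

Let mcut : measurable_fun setT (cutoff r).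
Proof. by apply: smooth_measurable; exact: smooth_cutoff. Qed.

Let mw : measurable_fun setT w.
Proof. exact: continuous_measurable_plane. Qed.

Let h y := om y * cutoff r y.
Let mh : measurable_fun setT h. Proof. exact: measurable_funM. Qed.
Let hW y : `|h y| <= W.
Proof.
by rewrite /h normrM -[leRHS]mulr1 ler_pM// norm_cutoff_le1.
Qed.
Let hr j y : h y != 0 -> `|coord j y| <= 2 * r.
Proof. by rewrite mulf_eq0 negb_or => /andP[_]; exact: cutoff_neq0_coord. Qed.
Let r20 : 0 <= 2 * r. Proof. by rewrite mulr_ge0 ?(ltW r0). Qed.

Let Ih e a := @integrable_mul_kernel R i e a _ _ _ r20 W0 mh hW (hr i).

Let dipole_split (f : R * R -> R) e :
  plane_integrable (fun y => f y * kernel i e x y) ->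
  plane_integrable (fun y => f y * kernel i e 0 y) ->
  \int[leb2 R]_y (f y * dipole i e x y) =
  \int[leb2 R]_y (f y * kernel i e x y) - \int[leb2 R]_y (f y * kernel i e 0 y).
Proof.
move=> I1 I2; rewrite -(RintegralB measurableT I1 I2).
by apply: eq_Rintegral => y _; rewrite /dipole mulrBr.
Qed.

Let limit_rhs : \int[leb2 R]_y (om y * (cutoff r y * dipole i (eps n) x y)) @[n --> \oo]
  --> \int[leb2 R]_y (h y * dipole i 0 x y).
Proof.
rewrite dipole_split; [|exact: Ih|exact: Ih].
have -> : (fun n => \int[leb2 R]_y (om y * (cutoff r y * dipole i (eps n) x y))) =
  (fun n => \int[leb2 R]_y (h y * kernel i (eps n) x y) -
    \int[leb2 R]_y (h y * kernel i (eps n) 0 y)).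
  apply/funext => n; rewrite -dipole_split; [|exact: Ih|exact: Ih].
  by apply: eq_Rintegral => y _; rewrite /h mulrA.
by apply: cvgB; exact: (@integral_mul_kernel_cvg _ _ _ _ _ _ r20 W0 mh hW (hr i)).
Qed.

Let g y := w y * cutoff r y.
Let mg : measurable_fun setT g. Proof. exact: measurable_funM. Qed.
Let cg : continuous g.
Proof. by move=> y; apply: cvgM; [exact: cw|exact/smooth_continuous/smooth_cutoff]. Qed.
Let gM y : `|g y| <= M.
Proof.
by rewrite /g normrM -[leRHS]mulr1 ler_pM// norm_cutoff_le1.
Qed.

Let Ig a n : plane_integrable (fun y => g y * mollifier (eps n) a y).
Proof.
apply: (plane_integrable_le _ _ (plane_integrableZ M (plane_integrable_mollifier a (eps_gt0 n)))).
  by apply: measurable_funM => //; exact: measurable_mollifier.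
by move=> y; rewrite normrM (ger0_norm (mollifier_ge0 _ _ _)) ler_wpM2r// mollifier_ge0.
Qed.

Let lhs_n n := \int[leb2 R]_y (g y * mollifier (eps n) x y) -
  \int[leb2 R]_y (g y * mollifier (eps n) 0 y).

Let limit_lhs : lhs_n n @[n --> \oo] --> 2 * pi * (w x - w 0).
Proof.
have gx a : sqnorm a <= r ^+ 2 -> g a = w a by move=> /cutoff_eq1; rewrite /g => ->; rewrite ?mulr1.
rewrite mulrBr -(gx x); last first.
  have Xr : X <= r by rewrite /X; move: xr (normr_ge0 x.1) (normr_ge0 x.2); lra.
  apply: (@le_trans _ _ (X ^+ 2)).
    rewrite /X sqrrD /sqnorm -(real_normK (num_real x.1)) -(real_normK (num_real x.2)).
    have : 0 <= `|x.1| * `|x.2| *+ 2 by rewrite mulrn_wge0// mulr_ge0.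
    lra.
  by rewrite ler_sqr ?nnegrE ?addr_ge0// ltW.
rewrite -(gx 0); last by rewrite /sqnorm /= expr0n addr0 sqr_ge0.
by apply: cvgB; apply: (approximate_identity mg gM); exact: cg.
Qed.

Let Ierr n : plane_integrable (err n).
Proof.
have [IA _] := integral_annulus_le r1.
exact: (plane_integrable_le (merr n) (errE n) (plane_integrableZ E IA)).
Qed.

Let regularized_estimate n :
  `|lhs_n n - \int[leb2 R]_y (om y * (cutoff r y * dipole i (eps n) x y))| <=
  E * (8 * (r * Num.sqrt r)).
Proof.
have I1 := Ig x n; have I2 := Ig 0 n.
have I3 : plane_integrable (fun y => g y * mollifier (eps n) x y - g y * mollifier (eps n) 0 y).
  by have := integrableB measurableT I1 I2.
rewrite -identity.
rewrite (_ : \int[leb2 R]_y _ = \int[leb2 R]_y ((g y * mollifier (eps n) x y -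
    g y * mollifier (eps n) 0 y) + err n y)); last first.
  by apply: eq_Rintegral => y _; rewrite /g; ring.
rewrite (RintegralD measurableT I3 (Ierr n)) (RintegralB measurableT I1 I2).
rewrite -/(lhs_n n) opprD addrA subrr sub0r -[X in `|X|]subr0 -opprD.
have I0 : plane_integrable (fun=> 0 : R) by apply: integrable0.
have := @integral_sub_annulus_le (err n) (fun=> 0) E r r1 E0 (Ierr n) I0.
rewrite Rintegral_cst// mul0r !subr0 addr0 normrN; apply => y.
by rewrite subr0; exact: errE.
Qed.

(** Letting e tend to 0 in the regularized identity produces 2 pi (w x - w 0) on the left,
    up to the boundary error, and the singular kernel on the right; replacing the smooth
    cutoff by the sharp disc costs one more integral over the annulus. *)
Lemma dipole_estimate :
  `|2 * pi * (w x - w 0) - \int[leb2 R]_(y in edisc r) (om y * dipole i 0 x y)| <=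
  (E + W * (8 * (`|x.1| + `|x.2|) / r ^+ 2)) * (8 * (r * Num.sqrt r)).
Proof.
rewrite -/X [leRHS]mulrDl.
have step1 : `|2 * pi * (w x - w 0) - \int[leb2 R]_y (h y * dipole i 0 x y)| <=
    E * (8 * (r * Num.sqrt r)).
  apply: (cvgr_to_le (cvg_norm (cvgB limit_lhs limit_rhs))).
  by near=> n; exact: regularized_estimate.
pose k y : R := om y * \1_(edisc r) y.
have mk : measurable_fun setT k.
  by apply: measurable_funM => //; apply: measurable_indic; exact: measurable_edisc (ltW r0).
have kW y : `|k y| <= W.
  rewrite /k normrM -[leRHS]mulr1 ler_pM// indicE.
  by case: (_ \in _); rewrite ?normr1 ?normr0.
have kr y : k y != 0 -> `|coord i y| <= 2 * r.
  rewrite mulf_eq0 negb_or => /andP[_]; rewrite (edisc_indicE _ (ltW r0)).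
  case: leP => [h1 _|]; last by rewrite eqxx.
  have /(sqnorm_coord r1)[] : sqnorm y <= r ^+ 2 + r by move: r0; lra.
  by case: (i).
have Ik a := @integrable_mul_kernel R i 0 a _ _ _ r20 W0 mk kW kr.
have Id (f : R * R -> R) : plane_integrable (fun y => f y * kernel i 0 x y) ->
    plane_integrable (fun y => f y * kernel i 0 0 y) ->
    plane_integrable (fun y => f y * dipole i 0 x y).
  move=> I1 I2; have := integrableB measurableT I1 I2.
  apply: eq_integrable => // y _ /=.
  by rewrite -EFinB -mulrBr.
have step2 : `|\int[leb2 R]_y (h y * dipole i 0 x y) - \int[leb2 R]_y (k y * dipole i 0 x y)| <=
    W * (8 * X / r ^+ 2) * (8 * (r * Num.sqrt r)).
  apply: integral_sub_annulus_le => //.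
  - apply: mulr_ge0 => //; apply: divr_ge0; last exact: sqr_ge0.
    by rewrite mulr_ge0// addr_ge0.
  - by apply: Id; exact: Ih.
  - by apply: Id; exact: Ik.
  move=> y; rewrite indicE; have [yA|yA] := boolP (y \in annulus r); last first.
    rewrite mulr0 -mulrBl /h /k -mulrBr -opprB disc_cutoff_diff//.
    by rewrite oppr0 mulr0 mul0r normr0.
  rewrite mulr1 -mulrBl normrM ler_pM//.
    rewrite /h /k -mulrBr normrM -[leRHS]mulr1 ler_pM//.
    have := step_ge0 (cutoff_arg r y); have := step_le1 (cutoff_arg r y).
    rewrite -/(cutoff r y) indicE => c1 c0.
    by rewrite ler_norml; case: (_ \in _) => /=; apply/andP; split; lra.
  apply: dipole_le => //.
  by move: yA; rewrite inE => /andP[].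
have -> : \int[leb2 R]_(y in edisc r) (om y * dipole i 0 x y) =
    \int[leb2 R]_y (k y * dipole i 0 x y).
  rewrite Rintegral_mkcond; apply: eq_Rintegral => y _; rewrite patchE /k indicE.
  by case: ifP => _; rewrite ?mulr1// mulr0 mul0r.
apply: (le_trans _ (lerD step1 step2)).
apply: (le_trans _ (ler_normD _ _)).
by rewrite le_eqVlt; apply/orP; left; apply/eqP; congr `|_|; ring.
Unshelve. all: by end_near. Qed.

End DipoleEstimate.
End Estimate.

(** * The two velocity components *)

Section FieldIdentities.
Context {R : realType}.
Variables (u : R * R -> R * R) (om : R * R -> R) (M W : R) (x : R * R).
Hypothesis div_u : distr_eq (div u) (fun=> 0).
Hypothesis curl_u : distr_eq (curl u) (distr_of om).
Hypothesis cu1 : continuous (fun y => (u y).1).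
Hypothesis cu2 : continuous (fun y => (u y).2).
Hypothesis uM1 : forall y, `|(u y).1| <= M.
Hypothesis uM2 : forall y, `|(u y).2| <= M.
Hypothesis mom : measurable_fun setT om.
Hypothesis omW : forall y, `|om y| <= W.

Let X := `|x.1| + `|x.2|.

Let mu1 : measurable_fun setT (fun y => (u y).1).
Proof. exact: continuous_measurable_plane. Qed.
Let mu2 : measurable_fun setT (fun y => (u y).2).
Proof. exact: continuous_measurable_plane. Qed.
Let M0 : 0 <= M. Proof. exact: le_trans (uM1 0). Qed.

Definition ddipole i e v y : R := dkernel i e x v y - dkernel i e 0 v y.

(** The terms in which a derivative falls on the cutoff; they live on the annulus. *)
Definition boundary_flux r e y : R :=
  dipole true e x y * dcutoff r e1 y + dipole false e x y * dcutoff r e2 y.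
Definition boundary_circulation r e y : R :=
  dipole true e x y * dcutoff r e2 y - dipole false e x y * dcutoff r e1 y.

Lemma smooth_dipole i e : 0 < e -> smooth (dipole i e x).
Proof. by move=> e0; apply: smoothB; exact: smooth_kernel. Qed.

Lemma is_derive_cutoff_dipole i r e v y : 0 < e ->
  is_derive y v (fun y => cutoff r y * dipole i e x y)
    (cutoff r y * ddipole i e v y + dipole i e x y * dcutoff r v y).
Proof.
move=> e0.
have Dk := is_deriveB (is_derive_kernel i x v y e0) (is_derive_kernel i 0 v y e0).
exact: (is_deriveM (is_derive_cutoff r v y) Dk).
Qed.

Lemma ddipole_div e y : 0 < e ->
  ddipole true e e1 y + ddipole false e e2 y = mollifier e x y - mollifier e 0 y.
Proof.
by move=> e0; rewrite -(div_kernel x y e0) -(div_kernel 0 y e0) /ddipole; ring.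
Qed.

Lemma ddipole_curl e y : ddipole true e e2 y = ddipole false e e1 y.
Proof. by rewrite /ddipole !curl_kernel. Qed.

Section FixedScale.
Variables (r : R).
Hypothesis (r1 : 1 <= r) (xr : 4 * X <= r).

Let r0 : 0 < r. Proof. exact: lt_le_trans ltr01 r1. Qed.

Lemma outside_box y : ~ (`|y.1| <= 2 * r /\ `|y.2| <= 2 * r) ->
  cutoff r y = 0 /\ forall v, dcutoff r v y = 0.
Proof.
move=> hy; have h : r ^+ 2 + r < sqnorm y.
  by rewrite ltNge; apply/negP => /(sqnorm_coord r1).
split; first by apply: cutoff_eq0 => //; exact: ltW.
move=> v; apply: dcutoff_eq0 => //; rewrite notin_setE /annulus /= => /andP[_].
by rewrite leNgt h.
Qed.

(** Weak equations tested against the field cutoff * dipole: its divergence is the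
    difference of two mollifiers and its curl vanishes, up to boundary terms, which
    isolates u.1. *)
Lemma field_identity1 e : 0 < e ->
  \int[leb2 R]_y ((u y).1 * (cutoff r y * (mollifier e x y - mollifier e 0 y)) +
    ((u y).1 * boundary_flux r e y + (u y).2 * boundary_circulation r e y)) =
  \int[leb2 R]_y (om y * (cutoff r y * dipole false e x y)).
Proof.
move=> e0; have sV i : smooth (fun y => cutoff r y * dipole i e x y).
  by apply: smoothM; [exact: smooth_cutoff|exact: smooth_dipole].
have L0 : 0 <= 2 * r by rewrite mulr_ge0// ltW.
pose d i v y := cutoff r y * ddipole i e v y + dipole i e x y * dcutoff r v y.
have D i v y : is_derive y v (fun y => cutoff r y * dipole i e x y) (d i v y).
  exact: is_derive_cutoff_dipole.
rewrite -(weak_div_curl div_u curl_u mu1 mu2 uM1 uM2 L0 (sV true) (sV false)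
  (D true e1) (D false e1) (D true e2) (D false e2)); last first.
  by move=> y /outside_box[c0 d0]; rewrite /d c0 !d0 !mul0r !mulr0 !addr0.
apply: eq_Rintegral => y _.
by rewrite -ddipole_div// /d /boundary_flux /boundary_circulation ddipole_curl; ring.
Qed.

(** The same field rotated by a right angle isolates u.2. *)
Lemma field_identity2 e : 0 < e ->
  \int[leb2 R]_y ((u y).2 * (cutoff r y * (mollifier e x y - mollifier e 0 y)) +
    ((u y).2 * boundary_flux r e y - (u y).1 * boundary_circulation r e y)) =
  \int[leb2 R]_y (- om y * (cutoff r y * dipole true e x y)).
Proof.
move=> e0; have sV i : smooth (fun y => cutoff r y * dipole i e x y).
  by apply: smoothM; [exact: smooth_cutoff|exact: smooth_dipole].
have L0 : 0 <= 2 * r by rewrite mulr_ge0// ltW.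
pose d i v y := cutoff r y * ddipole i e v y + dipole i e x y * dcutoff r v y.
have D i v y : is_derive y v (fun y => cutoff r y * dipole i e x y) (d i v y).
  exact: is_derive_cutoff_dipole.
have DN v y : is_derive y v (fun y => - (cutoff r y * dipole true e x y)) (- d true v y).
  exact: is_deriveN (D true v y).
transitivity (\int[leb2 R]_y (om y * - (cutoff r y * dipole true e x y))); last first.
  by apply: eq_Rintegral => y _; rewrite mulrN mulNr.
rewrite -(weak_div_curl div_u curl_u mu1 mu2 uM1 uM2 L0 (sV false) (smoothN (sV true))
  (D false e1) (DN e1) (D false e2) (DN e2)); last first.
  by move=> y /outside_box[c0 d0]; rewrite /d c0 !d0 !mul0r !mulr0 !addr0 oppr0.
apply: eq_Rintegral => y _.
by rewrite -ddipole_div// /d /boundary_flux /boundary_circulation ddipole_curl; ring.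
Qed.

Variable C : R.
Hypothesis C0 : 0 <= C.
Hypothesis dC : forall t : R, `|dstep t| <= C.

Lemma dcutoff_le b y : y \in annulus r -> `|dcutoff r (if b then e1 else e2) y| <= 4 * C.
Proof.
rewrite inE => /andP[_ /(sqnorm_coord r1)[y1 y2]].
rewrite /dcutoff normrM mulrC ler_pM//.
have h (c : R) : `|c| <= 2 * r -> `|2 * c / r| <= 4.
  move=> hc; rewrite !normrM normfV (gtr0_norm r0) ler_pdivrMr// ger0_norm//; lra.
by case: b; rewrite /= ?mulr1 ?mulr0 ?addr0 ?add0r; apply: h.
Qed.

Let D := 8 * X / r ^+ 2.

Let D0 : 0 <= D.
Proof. by apply: divr_ge0; [rewrite mulr_ge0// addr_ge0|exact: sqr_ge0]. Qed.

Lemma pair_product_le (a b c d A B : R) : `|a| <= A -> `|b| <= A -> `|c| <= B -> `|d| <= B ->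
  `|a * c + b * d| <= 2 * (A * B).
Proof.
move=> ha hb hc hd; rewrite (le_trans (ler_normD _ _))// !normrM mulr_natl mulr2n.
by rewrite lerD// ler_pM.
Qed.

Lemma boundary_flux_le e y : y \in annulus r -> `|boundary_flux r e y| <= 2 * (D * (4 * C)).
Proof.
move=> yA; have ry : r ^+ 2 <= sqnorm y by move: yA; rewrite inE => /andP[].
apply: pair_product_le; [exact: dipole_le|exact: dipole_le|..].
  exact: (dcutoff_le true).
exact: (dcutoff_le false).
Qed.

Lemma boundary_circulation_le e y : y \in annulus r ->
  `|boundary_circulation r e y| <= 2 * (D * (4 * C)).
Proof.
move=> yA; have ry : r ^+ 2 <= sqnorm y by move: yA; rewrite inE => /andP[].
rewrite /boundary_circulation -mulrN; apply: pair_product_le; [exact: dipole_le|exact: dipole_le|..].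
  exact: (dcutoff_le false).
by rewrite normrN; exact: (dcutoff_le true).
Qed.

Let E := 2 * (M * (2 * (D * (4 * C)))).

Lemma boundary_error_le (a b : R) e y : `|a| <= M -> `|b| <= M ->
  `|a * boundary_flux r e y + b * boundary_circulation r e y| <= E * \1_(annulus r) y.
Proof.
move=> ha hb; rewrite indicE; have [yA|yA] := boolP (y \in annulus r).
  by rewrite mulr1; apply: pair_product_le => //; [exact: boundary_flux_le|exact: boundary_circulation_le].
by rewrite /boundary_flux /boundary_circulation !dcutoff_eq0// !(mulr0, addr0, subr0, normr0).
Qed.

Lemma measurable_dcutoff v : measurable_fun setT (dcutoff r v).
Proof.
apply: smooth_measurable; apply: (smooth_of_is_derive (smooth_cutoff r)) => y.
exact: is_derive_cutoff.
Qed.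

Lemma measurable_dipole i e : measurable_fun setT (dipole i e x).
Proof. by apply: measurable_funB; exact: measurable_kernel. Qed.

Lemma measurable_boundary_flux e : measurable_fun setT (boundary_flux r e).
Proof.
by apply: measurable_funD; apply: measurable_funM;
  first [exact: measurable_dipole|exact: measurable_dcutoff].
Qed.

Lemma measurable_boundary_circulation e : measurable_fun setT (boundary_circulation r e).
Proof.
by apply: measurable_funB; apply: measurable_funM;
  first [exact: measurable_dipole|exact: measurable_dcutoff].
Qed.

Let E0 : 0 <= E. Proof. by do 5?apply: mulr_ge0 => //. Qed.

Lemma velocity_estimate1 :
  `|2 * pi * ((u x).1 - (u 0).1) -
    \int[leb2 R]_(y in edisc r) (om y * dipole false 0 x y)| <=
  (E + W * D) * (8 * (r * Num.sqrt r)).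
Proof.
apply: (@dipole_estimate R (fun y => (u y).1) om M W false x r E
  (fun n y => (u y).1 * boundary_flux r (eps n) y + (u y).2 * boundary_circulation r (eps n) y)) => //.
- move=> n; apply: measurable_funD; apply: measurable_funM => //.
    exact: measurable_boundary_flux.
  exact: measurable_boundary_circulation.
- by move=> n y; exact: boundary_error_le.
- by move=> n; apply: field_identity1; exact: eps_gt0.
Qed.

Lemma velocity_estimate2 :
  `|2 * pi * ((u x).2 - (u 0).2) -
    \int[leb2 R]_(y in edisc r) (- om y * dipole true 0 x y)| <=
  (E + W * D) * (8 * (r * Num.sqrt r)).
Proof.
apply: (@dipole_estimate R (fun y => (u y).2) (fun y => - om y) M W true x r E
  (fun n y => (u y).2 * boundary_flux r (eps n) y - (u y).1 * boundary_circulation r (eps n) y)) => //.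
- exact: measurableT_comp.
- by move=> y; rewrite normrN.
- move=> n; apply: measurable_funB; apply: measurable_funM => //.
    exact: measurable_boundary_flux.
  exact: measurable_boundary_circulation.
- by move=> n y; rewrite -mulNr; apply: boundary_error_le; rewrite ?normrN.
- by move=> n; apply: field_identity2; exact: eps_gt0.
Qed.

End FixedScale.
End FieldIdentities.

(** * Bounded data and the limit *)

Section Convergence.
Context {R : realType}.

(** Truncating at an almost everywhere bound changes omega on a null set only, hence none of
    its integrals, and gives a bound that holds everywhere. *)
Lemma Linfty_bounded_representative (omega : R * R -> R) :
  omega \in Lfun (leb2 R) +oo%E ->
  exists (W : R) (om : R * R -> R), [/\ measurable_fun setT om, forall y, `|om y| <= W &
    forall (D : set (R * R)) (f : R * R -> R), measurable D -> measurable_fun D f ->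
      \int[leb2 R]_(y in D) (omega y * f y) = \int[leb2 R]_(y in D) (om y * f y)].
Proof.
move=> oL.
have mo : measurable_fun setT omega := set_mem (sub_Lfun_mfun oL).
have : finite_norm (leb2 R) +oo%E omega := set_mem (sub_Lfun_finLfun oL).
rewrite /finite_norm unlock => fin.
have [W oW] : exists W, {ae leb2 R, forall y, `|omega y| <= W}.
  move: fin; case: ifPn => [_ fin|].
    have [W HW] := @ess_supr_bounded _ _ _ (leb2 R) (fun y => `|omega y|) fin.
    by exists W.
  rewrite -leNgt measure_le0 => /eqP m0; exists 0.
  by exists setT; split.
pose om y := Num.max (- `|W|) (Num.min `|W| (omega y)).
have mom : measurable_fun setT om.
  apply: measurable_maxr; first exact: measurable_cst.
  by apply: measurable_minr => //; exact: measurable_cst.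
exists `|W|, om; split => //.
  move=> y; rewrite ler_norml /om; apply/andP; split; first by rewrite le_max lexx.
  rewrite ge_max; apply/andP; split; last by rewrite ge_min lexx.
  by rewrite (le_trans _ (normr_ge0 W))// oppr_le0.
move=> D f mD mf; rewrite /Rintegral; congr fine.
apply: ae_eq_integral => //.
- by apply/measurable_EFinP/measurable_funM => //; exact: measurable_funTS.
- by apply/measurable_EFinP/measurable_funM => //; exact: measurable_funTS.
case: oW => N [mN N0 oN]; exists N; split => // y /= ny; apply: oN => /= yW.
apply: ny => _; congr ((_ * _)%:E).
have : `|omega y| <= `|W| by rewrite (le_trans yW)// ler_norm.
by rewrite ler_norml => /andP[h1 h2]; rewrite /om min_r// max_r.
Qed.

Lemma BUC_components (u : R * R -> R * R) : BUC u ->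
  [/\ continuous (fun y => (u y).1), continuous (fun y => (u y).2) &
   exists M, forall y, `|(u y).1| <= M /\ `|(u y).2| <= M].
Proof.
move=> [[M [_ HM]] /unif_continuousP uc].
have cu : continuous u.
  move=> y; apply/cvgrPdist_lt => e e0; have [d d0 Hd] := uc _ e0.
  apply: filterS (nbhsx_ballx y _ d0) => z yz.
  by have := Hd (y, z) yz; rewrite -ball_normE.
split.
- by move=> y; apply: (@continuous_comp _ _ _ u fst); [exact: cu|exact: cvg_fst].
- by move=> y; apply: (@continuous_comp _ _ _ u snd); [exact: cu|exact: cvg_snd].
exists (M + 1) => y; have /(_ y I) : forall z, setT z -> `|u z| <= M + 1.
  by apply: HM; rewrite ltrDl.
by rewrite prod_normE ge_max => /andP.
Qed.

(** The error has the form K / r ^ 2 * (r * sqrt r) = K / sqrt r: the dipole decays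
    like r ^ -2 while the annulus has area O(r ^ (3/2)). *)
Lemma inv_sqrt_rate_cvg (T : R -> R) (K l r0 : R) : 0 <= K ->
  (forall r, r0 <= r -> 1 <= r -> `|l - T r| <= K / r ^+ 2 * (r * Num.sqrt r)) ->
  T r @[r --> +oo] --> l.
Proof.
move=> K0 H; apply/cvgrPdist_le => e e0; near=> r.
have r1 : 1 <= r by near: r; apply: nbhs_pinfty_ge => //; exact: num_real.
have rr0 : r0 <= r by near: r; apply: nbhs_pinfty_ge => //; exact: num_real.
have rK : (K / e) ^+ 2 <= r by near: r; apply: nbhs_pinfty_ge => //; exact: num_real.
apply: le_trans (H r rr0 r1) _.
have s0 : 0 < Num.sqrt r by rewrite sqrtr_gt0; lra.
have Ke : K / e <= Num.sqrt r.
  by rewrite -[leLHS]ger0_norm ?divr_ge0 ?(ltW e0)// -sqrtr_sqr ler_wsqrtr.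
have rE : r = Num.sqrt r ^+ 2 by rewrite sqr_sqrtr//; lra.
have -> : K / r ^+ 2 * (r * Num.sqrt r) = K / Num.sqrt r.
  by rewrite {1 2}rE; field; rewrite gt_eqF.
by rewrite ler_pdivrMr// mulrC -ler_pdivrMr.
Unshelve. all: by end_near. Qed.

(** The rotated kernel K(x - y) + K(y) has the components of the dipole, exchanged and
    with one sign. *)
Lemma BS_kernel_dipole (x y : R * R) :
  BS_kernel (x - y) + BS_kernel y = (dipole false 0 x y, - dipole true 0 x y).
Proof.
have E (z : R * R) : enorm z ^+ 2 = z.1 ^+ 2 + z.2 ^+ 2.
  by rewrite /enorm sqr_sqrtr// addr_ge0// sqr_ge0.
have S0 : shifted_sqr 0 0 y = y.1 ^+ 2 + y.2 ^+ 2.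
  by rewrite /shifted_sqr expr0n add0r !subr0.
have Sx : shifted_sqr 0 x y = (x - y).1 ^+ 2 + (x - y).2 ^+ 2.
  by rewrite /shifted_sqr expr0n add0r /=; ring.
rewrite /BS_kernel !E /dipole /kernel S0 Sx /coord /perp /=.
by apply/pair_equal_spec; split; rewrite /= /GRing.scale /=; ring.
Qed.

End Convergence.

Theorem proposition4p2 (R : realType) (u : R * R -> R * R) (omega : R * R -> R)
    (uX : BUC u)
    (div_u : distr_eq (div u) (fun=> 0))
    (curl_u : distr_eq (curl u) (distr_of omega))
    (omegaLoo : omega \in Lfun (leb2 R) +oo%E)
    (x : R * R) :
  exists2 l : R * R,
    BS_truncated omega x r @[r --> +oo] --> l & u x = u 0 + l.
Proof.
have [W [om [mom omW omE]]] := Linfty_bounded_representative omegaLoo.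
have [cu1 cu2 [M uM]] := BUC_components uX.
have uM1 y : `|(u y).1| <= M by have [] := uM y.
have uM2 y : `|(u y).2| <= M by have [] := uM y.
have W0 : 0 <= W by apply: le_trans (omW 0).
have M0 : 0 <= M by apply: le_trans (uM1 0).
have curl_om : distr_eq (curl u) (distr_of om).
  move=> phi tphi; rewrite curl_u// /distr_of omE//.
  by apply: continuous_measurable_plane; have [/(_ 0%N)] := tphi.
have [C C0 dC] := @dstep_bounded R.
pose X := `|x.1| + `|x.2|.
(* Collects the constants of the two velocity estimates, see KE. *)
pose K := 64 * X * (16 * M * C + W).
have X0 : 0 <= X by rewrite addr_ge0.
have K0 : 0 <= K by do !(apply: mulr_ge0 || apply: addr_ge0) => //.
have KE r : (2 * (M * (2 * (8 * X / r ^+ 2 * (4 * C)))) + W * (8 * X / r ^+ 2)) *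
    (8 * (r * Num.sqrt r)) = K / r ^+ 2 * (r * Num.sqrt r).
  by rewrite /K; ring.
have lim1 : \int[leb2 R]_(y in edisc r) (om y * dipole false 0 x y) @[r --> +oo] -->
    2 * pi * ((u x).1 - (u 0).1).
  apply: (@inv_sqrt_rate_cvg R _ K _ (4 * X)) => // r xr r1; rewrite -KE.
  exact: velocity_estimate1.
have lim2 : \int[leb2 R]_(y in edisc r) (- om y * dipole true 0 x y) @[r --> +oo] -->
    2 * pi * ((u x).2 - (u 0).2).
  apply: (@inv_sqrt_rate_cvg R _ K _ (4 * X)) => // r xr r1; rewrite -KE.
  exact: velocity_estimate2.
have pi2 : (2 * pi : R) != 0 by rewrite gt_eqF// mulr_gt0// pi_gt0.
exists (u x - u 0); last by rewrite addrC subrK.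
have -> : u x - u 0 = ((2 * pi)^-1 * (2 * pi * ((u x).1 - (u 0).1)),
    (2 * pi)^-1 * (2 * pi * ((u x).2 - (u 0).2))).
  by rewrite !mulKf//; case: (u x) (u 0) => [a b] [c d].
have BSE : \forall r \near +oo,
   ((2 * pi)^-1 * \int[leb2 R]_(y in edisc r) (om y * dipole false 0 x y),
    (2 * pi)^-1 * \int[leb2 R]_(y in edisc r) (- om y * dipole true 0 x y)) =
   BS_truncated omega x r.
  near=> r; have r0 : 0 <= r by near: r; apply: nbhs_pinfty_ge => //; exact: num_real.
  have mD := measurable_edisc r0; apply/esym.
  rewrite /BS_truncated /vintegral.
  transitivity ((2 * pi)^-1 *: (\int[leb2 R]_(y in edisc r) (om y * dipole false 0 x y),
    \int[leb2 R]_(y in edisc r) (- om y * dipole true 0 x y))); last by [].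
  congr (_ *: (_, _)).
    rewrite -omE//; last by apply: measurable_funTS; exact: measurable_dipole.
    by apply: eq_Rintegral => y _; rewrite BS_kernel_dipole.
  transitivity (\int[leb2 R]_(y in edisc r) (om y * - dipole true 0 x y)).
    rewrite -omE//; last first.
      by apply: measurable_funTS; apply: measurableT_comp => //; exact: measurable_dipole.
    by apply: eq_Rintegral => y _; rewrite BS_kernel_dipole.
  by apply: eq_Rintegral => y _; rewrite mulrN mulNr.
have c1 : (2 * pi)^-1 * \int[leb2 R]_(y in edisc r) (om y * dipole false 0 x y) @[r --> +oo]
    --> (2 * pi)^-1 * (2 * pi * ((u x).1 - (u 0).1)).
  by apply: cvgM; [exact: cvg_cst|exact: lim1].
have c2 : (2 * pi)^-1 * \int[leb2 R]_(y in edisc r) (- om y * dipole true 0 x y) @[r --> +oo]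
    --> (2 * pi)^-1 * (2 * pi * ((u x).2 - (u 0).2)).
  by apply: cvgM; [exact: cvg_cst|exact: lim2].
exact: (cvg_trans (near_eq_cvg BSE) (cvg_pair c1 c2)).
Unshelve. all: by end_near. Qed.
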